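(* Let $p=3$ and $q=p^m$, where $m\ge 6$ is an even integer. With the counts $n_{\varepsilon,j}$, $n_1$, $n_3$ of values of the exponential sum $S(\alpha,\beta,\gamma)$ and the numbers $a,b,c_1,\dots,c_6$ given in the context, the following hold: $$n_{1,0}=-\frac{b + c_6 - ap^2 - ap^3 - ap^4 - ap^5 - bp^2 + c_1p^6 + c_2p^6 + c_3p^3 + c_3p^5 - c_4p^2 - c_4p^4 + c_5p^2}{- 2p^6 + 2p^4 + 2p^2 - 2},$$ $$n_{-1,0}=-\frac{b - c_6 - ap^2 - ap^3 - ap^4 - ap^5 - bp^2 + c_1p^6 - c_2p^6 + c_3p^3 + c_3p^5 + c_4p^2 + c_4p^4 + c_5p^2}{- 2p^6 + 2p^4 + 2p^2 - 2},$$ $$2n_1=\frac{-(b - c_5 + ap^3 - c_3p^3)}{p^2 - p^4},$$ $$n_{1,2}=\frac{c_4 - c_6 + ap - c_5p + ap^2 + ap^4 + ap^5 - c_1p^5 - c_2p^4 - c_3p^2 - c_3p^4 + c_4p^4}{2p^7 - 4p^5 + 2p^3},$$ $$n_{-1,2}=-\frac{c_4 - c_6 - ap + c_5p - ap^2 - ap^4 - ap^5 + c_1p^5 - c_2p^4 + c_3p^2 + c_3p^4 + c_4p^4}{2p^7 - 4p^5 + 2p^3},$$ $$2n_3=\frac{b - c_5 + ap - c_3p}{p^4 - p^6},$$ $$n_{1,4}=-\frac{b + c_4 - c_5 - c_6 + ap - c_3p + ap^2 + ap^3 + ap^4 - bp^2 - c_1p^4 - c_2p^2 - c_3p^3 +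 c_4p^2}{2p^{10} - 2p^8 - 2p^6 + 2p^4},$$ $$n_{-1,4}=-\frac{b - c_4 - c_5 + c_6 + ap - c_3p + ap^2 + ap^3 + ap^4 - bp^2 - c_1p^4 + c_2p^2 - c_3p^3 - c_4p^2}{2p^{10} - 2p^8 - 2p^6 + 2p^4}.$$
   Context: Let $\mathrm{Tr}:\mathbb{F}_q\to\mathbb{F}_p$ be the trace map and $\zeta_p=e^{2\pi i/p}$. For $\alpha,\beta,\gamma\in\mathbb{F}_q$ put $S(\alpha,\beta,\gamma)=\sum_{x\in\mathbb{F}_q}\zeta_p^{\mathrm{Tr}(\alpha x^2+\beta x^{p+1}+\gamma x^{p^2+1})}$. For $\varepsilon=\pm1$, let $n_{\varepsilon,j}$ be the number of $(\alpha,\beta,\gamma)\in\mathbb{F}_q^3\setminus\{(0,0,0)\}$ with $S(\alpha,\beta,\gamma)=\varepsilon p^{(m+j)/2}$ if $j\in\{0,2,4\}$, and with $S(\alpha,\beta,\gamma)=\varepsilon\, i\, p^{(m+j)/2}$ ($i$ the imaginary unit) if $j\in\{1,3\}$. For $j\in\{1,3\}$ one has $n_{1,j}=n_{-1,j}$, and this common value is denoted $n_j$. The constants are $c_1=p^{3m}-1$, $c_2=p^{m/2}(p^{2m}-1)$, $c_3=p^m(p^m-1)$, $c_4=(p+1)p^{3m/2}(p^m-1)$, $c_5=\left(8(p^m-1)^2-p^m+1\right)p^m$, $c_6=\left(5(p^m-1)(8p^m-2p-10)-p^{2m}+1\right)p^{m/2}$, and, with $A_2'=p^m-1$ and $A_4'=\frac{(p^m-1)(2p^m-p-3)}{3}+\frac{(p^m-1)(p^m-3)}{2}$,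 $$a=\frac{p^{3m-2}\left((p^m-1)(p^m-2)(p-1)^2+2A_2'\right)-p^{2(m-1)}(p-1)^2(p^{3m}-2p^{2m}+1)+(p-1)(p^m-1)p^{3m-1}}{(p-1)^2p^{m-2}},$$ $$\begin{aligned} b=\Big\{&p^{3m-4}\big[(p^m-1)(p^m-2)(p^m-3)(p^m-4)(p-1)^4+12A_2'(p^m-3)(p^m-4)(p-1)^2+24A_4'\big]\\&-(p-1)^5p^{3(m-1)}a-p^{4(m-1)}(p-1)^4(p^{3m}-4p^{2m}-16p^m+19)\\&+6\big[(p-1)^3p^{2(m-1)}a+p^{3(m-1)}(p-1)^3(p^{3m}-p^{2m+1}-4p^m+6)\big]\\&-11\big[(p-1)^2p^{m-2}a+p^{2(m-1)}(p-1)^2(p^{3m}-2p^{2m}+1)\big]\\&+6(p-1)(p^m-1)p^{3m-1}\Big\}\Big/\left((p-1)^4p^{2m-4}\right).\end{aligned}$$ *)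

(* Defs.v *)
From HB Require Import structures.
From mathcomp Require Import all_boot all_order all_algebra all_fingroup all_field.
From mathcomp Require Import reals trigo exp.
From mathcomp Require Import complex.

Set Implicit Arguments.
Unset Strict Implicit.
Unset Printing Implicit Defensive.

Import Order.TTheory GRing.Theory Num.Theory.

Local Open Scope ring_scope.

Section Trace.

Variables (p m : nat) (F : finFieldType).

Definition conj_sum (x : F) : F := \sum_(i < m) x ^+ (p ^ i).

(* The trace of F over 'F_p: the element of 'F_p whose image in F is the sum
   of the conjugates of x, that is galTrace (conj_sum_galTrace). When p is
   prime and #|F| = p ^ m there is exactly one such element (TrP, natrFp_inj),
   so that the default value 0 is irrelevant. *)
Definition Tr (x : F) : 'F_p :=
  odflt 0 [pick k : 'F_p | (k : nat)%:R == conj_sum x].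

Hypotheses (p_pr : prime p) (cardF : #|F| = (p ^ m)%N).

Let pcharF : p \in [pchar F] := card_finPcharP cardF p_pr.

Lemma conj_sum_galTrace x :
  conj_sum x = galTrace 1%AS {:pPrimeCharType pcharF} x.
Proof.
pose L := pPrimeCharType pcharF.
have [a gen_a aE] := finField_galois_generator (sub1v {:L}).
have dimL : \dim {:L} = m.
  have e : (p ^ \dim {:L} = p ^ m)%N.
    rewrite -[RHS]cardF -[X in (X ^ _)%N](card_Fp p_pr).
    exact: etrans (esym (card_vspace _)) (card_vspacef _).
  by apply/eqP; rewrite -(eqn_exp2l _ _ (prime_gt1 p_pr)) e.
have defG : ('Gal({:L} / 1) = <[a]>)%g by apply/eqP.
have ord_a : #[a]%g = m.
  rewrite orderE -defG -galois_dim ?finField_galois ?sub1v //.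
  by rewrite dimv1 divn1 dimL.
have aX i : (a ^+ i)%g x = x ^+ (p ^ i).
  elim: i => [|i IHi]; first by rewrite expg0 gal_id expr1.
  rewrite expgSr galM ?memvf // IHi aE ?memvf // -exprM.
  by rewrite dimv1 expn1 card_Fp // expnSr.
have uniq_a : uniq (traject ( *%g a) 1%g m).
  by apply/card_uniqP; rewrite size_traject -ord_a -(eq_card (cycle_traject a)).
rewrite /galTrace defG (eq_bigl _ _ (cycle_traject a)) ord_a.
rewrite -big_uniq //= (big_nth 1%g) size_traject big_mkord /conj_sum.
apply: eq_bigr => i _; rewrite nth_traject //.
have -> : iter i ( *%g a) 1%g = (a ^+ i)%g.
  by elim: (nat_of_ord i) => //= n ->; rewrite expgS.
by rewrite aX.
Qed.

Lemma TrP x : (Tr x : nat)%:R = conj_sum x.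
Proof.
rewrite /Tr; case: pickP => [k /eqP //|noK].
have : galTrace 1%AS {:pPrimeCharType pcharF} x \in 1%VS.
  by rewrite mem_galTrace ?memvf // finField_galois ?sub1v.
rewrite -conj_sum_galTrace => /vlineP [k kE].
by case/eqP: (noK k); rewrite kE; apply/esym/mulr1.
Qed.

Lemma natrFp_inj : injective (fun k : 'F_p => (k : nat)%:R : F).
Proof.
move=> k l /= kl; apply: (fmorph_inj (in_alg (pPrimeCharType pcharF))).
by apply: etrans (mulr1 _) _; apply: etrans kl (esym (mulr1 _)).
Qed.

Lemma TrN x : Tr (- x) = - Tr x.
Proof.
apply: natrFp_inj => /=; rewrite TrP.
have -> : ((- Tr x : 'F_p) : nat)%:R = - (Tr x : nat)%:R :> F.
  have e := rmorphN (in_alg (pPrimeCharType pcharF)) (Tr x).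
  apply: etrans (esym (mulr1 _)) (etrans e _).
  by congr (- _); apply: mulr1.
rewrite TrP /conj_sum -sumrN; apply: eq_bigr => i _.
by rewrite exprNn_pchar // pnatX pnatE ?pcharF.
Qed.

End Trace.

Section ExponentialSum.

Variables (R : realType) (p m : nat) (F : finFieldType).

(* e ^ (2 pi i / p) *)
Definition zeta : R[i] :=
  (cos (2 * pi / p%:R) +i* sin (2 * pi / p%:R))%C.

Definition expsum (alpha beta gamma : F) : R[i] :=
  \sum_(x : F)
    zeta ^+ Tr p m (alpha * x ^+ 2 + beta * x ^+ p.+1 + gamma * x ^+ (p ^ 2).+1).

Definition expsum_value (eps : int) (j : nat) : R[i] :=
  eps%:~R * (if odd j then 'i%C else 1) * (p%:R `^ ((m + j)%:R / 2))%:C%C.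

Definition nval (eps : int) (j : nat) : nat :=
  #|[set t : F * F * F | (t != (0, 0, 0)) &&
      (expsum t.1.1 t.1.2 t.2 == expsum_value eps j)]|.

(* Only for odd j: the common value of nval 1 j and nval (-1) j (nval_odd_opp). *)
Definition nval_odd (j : nat) : nat := nval 1 j.

Hypotheses (p_pr : prime p) (cardF : #|F| = (p ^ m)%N).

Lemma zetaX n : zeta ^+ n =
  (cos (n%:R * (2 * pi / p%:R)) +i* sin (n%:R * (2 * pi / p%:R)))%C.
Proof.
rewrite /zeta; set th := 2 * pi / _.
elim: n => [|n IHn]; first by rewrite expr0 mul0r cos0 sin0.
rewrite exprSr IHn -(natr1 n) mulrDl mul1r cosD sinD.
by apply/eqP; rewrite eq_complex /= eqxx addrC eqxx.
Qed.

Lemma zetaXp : zeta ^+ p = 1.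
Proof.
have p0 : p%:R != 0 :> R by rewrite pnatr_eq0 -lt0n prime_gt0.
by rewrite zetaX mulrC divfK // mulr_natl cos2pi sin2pi.
Qed.

Lemma conj_zeta : zeta * (zeta^*)%C = 1.
Proof.
apply/eqP; rewrite eq_complex /= mulrN opprK -!expr2 cos2Dsin2 eqxx.
by rewrite mulrN mulrC addNr eqxx.
Qed.

Lemma conj_expsum alpha beta gamma :
  expsum (- alpha) (- beta) (- gamma) = ((expsum alpha beta gamma)^*)%C.
Proof.
rewrite /expsum rmorph_sum; apply: eq_bigr => x _ /=.
rewrite !mulNr -!opprD TrN // rmorphXn /=.
set k := Tr _ _ _.
have z0 : zeta ^+ k != 0.
  rewrite expf_neq0 //; apply/eqP=> z0; have /esym/eqP := conj_zeta.
  by rewrite z0 mul0r oner_eq0.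
apply: (mulfI z0); rewrite -exprMn conj_zeta expr1n -exprD.
suff /dvdnP [d ->] : (p %| k + (- k : 'F_p))%N.
  by rewrite mulnC exprM zetaXp expr1n.
have := subrr k; move/(congr1 (fun l : 'F_p => l : nat)) => /=.
by move/eqP; rewrite -/(dvdn _ _) [X in (X %| _)%N](Fp_cast p_pr).
Qed.

Lemma nval_odd_opp j : odd j -> nval (-1) j = nval_odd j.
Proof.
move=> j_odd; rewrite /nval_odd /nval.
pose f (t : F * F * F) := (- t.1.1, - t.1.2, - t.2).
have fK : involutive f by case=> [[? ?] ?]; rewrite /f /= !opprK.
rewrite -[RHS](card_preimset _ (inv_inj fK)); apply: eq_card => -[[x y] z].
rewrite !inE /f /= conj_expsum !xpair_eqE !oppr_eq0; congr (_ && _).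
have -> : expsum_value 1 j = ((expsum_value (-1) j)^*)%C.
  rewrite /expsum_value j_odd rmorphN mulN1r mul1r mulNr rmorphN /=.
  apply/eqP; rewrite eq_complex /=.
  by rewrite !(mul0r, mulr0, mul1r, subr0, oppr0, add0r, addr0, opprK) !eqxx.
by rewrite (inj_eq (can_inj (@conjcK R))).
Qed.

End ExponentialSum.

(* The exponents m./2 and (3 * m)./2 are exact for even m, and the truncated
   subtractions in the other ones are exact for 2 <= m. *)
Section Constants.

Variables p m : nat.

Local Notation P := (p%:R : rat).

Definition c1 : rat := P ^+ (3 * m) - 1.
Definition c2 : rat := P ^+ m./2 * (P ^+ (2 * m) - 1).
Definition c3 : rat := P ^+ m * (P ^+ m - 1).
Definition c4 : rat := (P + 1) * P ^+ (3 * m)./2 * (P ^+ m - 1).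
Definition c5 : rat := (8 * (P ^+ m - 1) ^+ 2 - P ^+ m + 1) * P ^+ m.
Definition c6 : rat :=
  (5 * (P ^+ m - 1) * (8 * P ^+ m - 2 * P - 10) - P ^+ (2 * m) + 1) * P ^+ m./2.

Definition A2' : rat := P ^+ m - 1.
Definition A4' : rat :=
  (P ^+ m - 1) * (2 * P ^+ m - P - 3) / 3 + (P ^+ m - 1) * (P ^+ m - 3) / 2.

Definition a_const : rat :=
  (P ^+ (3 * m - 2) * ((P ^+ m - 1) * (P ^+ m - 2) * (P - 1) ^+ 2 + 2 * A2')
   - P ^+ (2 * (m - 1)) * (P - 1) ^+ 2 * (P ^+ (3 * m) - 2 * P ^+ (2 * m) + 1)
   + (P - 1) * (P ^+ m - 1) * P ^+ (3 * m - 1))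
  / ((P - 1) ^+ 2 * P ^+ (m - 2)).

Definition b_const : rat :=
  (P ^+ (3 * m - 4) *
     ((P ^+ m - 1) * (P ^+ m - 2) * (P ^+ m - 3) * (P ^+ m - 4) * (P - 1) ^+ 4
      + 12 * A2' * (P ^+ m - 3) * (P ^+ m - 4) * (P - 1) ^+ 2
      + 24 * A4')
   - (P - 1) ^+ 5 * P ^+ (3 * (m - 1)) * a_const
   - P ^+ (4 * (m - 1)) * (P - 1) ^+ 4
     * (P ^+ (3 * m) - 4 * P ^+ (2 * m) - 16 * P ^+ m + 19)
   + 6 * ((P - 1) ^+ 3 * P ^+ (2 * (m - 1)) * a_const
          + P ^+ (3 * (m - 1)) * (P - 1) ^+ 3
            * (P ^+ (3 * m) - P ^+ (2 * m + 1) - 4 * P ^+ m + 6))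
   - 11 * ((P - 1) ^+ 2 * P ^+ (m - 2) * a_const
           + P ^+ (2 * (m - 1)) * (P - 1) ^+ 2
             * (P ^+ (3 * m) - 2 * P ^+ (2 * m) + 1))
   + 6 * (P - 1) * (P ^+ m - 1) * P ^+ (3 * m - 1))
  / ((P - 1) ^+ 4 * P ^+ (2 * m - 4)).

End Constants.

(* Main.v *)
Require Import Defs.
From mathcomp Require Import all_boot all_order all_algebra all_fingroup all_field.
From mathcomp Require Import reals trigo exp.
From mathcomp Require Import complex ring lra zify.

Import Order.TTheory GRing.Theory Num.Theory.

Local Open Scope ring_scope.

(* |S(t)|^2 = q |Rad|, where the radical Rad of the quadratic form is the kernel
   of a nonzero 3-linearized polynomial of degree at most 81; so |S|^2 = 3^(m+j)
   with j <= 4. The form is even in x, hence S = 1 + 2 w with w in Z[zeta], that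
   is S = A + B sqrt(-3) with A, B integers, and A^2 + 3 B^2 = 3^(m+j) forces one
   of A, B to vanish by descent: S takes only the ten listed values.

   By orthogonality the moments of (S, conj S) count the solutions of systems of
   equations between the power sums of degree 1, 2 and 5 of squares, which are
   solved by Newton's identities in characteristic 3. The values with odd j are
   imaginary and come in opposite pairs, so they cancel in every moment of odd
   order, whatever the number of conjugated factors: in orders 3 and 5 the
   factors are conjugated so as to get the easiest system. In order 4,
   S^3 conj S = (-1)^j |S|^4 separates the even values from the odd ones, and
   likewise S^2 and |S|^2 in order 2. The orders 0 to 5 give eight linear
   equations for the eight counts. *)

(** * Power sums in characteristic 3 *)

Section PowerSums.
Set Implicit Arguments.
Unset Strict Implicit.

Variable F : fieldType.
Hypothesis three0 : 3 = 0 :> F.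

Lemma char3_two : 2 = - 1 :> F.
Proof. by transitivity (3 - 1 : F); [ring | rewrite three0 sub0r]. Qed.

Lemma char3_two_neq0 : 2 != 0 :> F.
Proof. by rewrite char3_two oppr_eq0 oner_eq0. Qed.

Lemma char3_five_neq0 : 5 != 0 :> F.
Proof. by rewrite (natrD _ 3 2) three0 add0r char3_two_neq0. Qed.

(** As 2 is invertible, the first two power sums fix the sum and the product, hence the unordered
    pair. With two terms on each side, the equation of degree 5 thus follows from the other two. *)
Lemma power_sums2 (X Y U V : F) :
  X + Y = U + V -> X ^+ 2 + Y ^+ 2 = U ^+ 2 + V ^+ 2 ->
  X = U /\ Y = V \/ X = V /\ Y = U.
Proof.
move=> e1 e2; have YE : Y = U + V - X by rewrite -e1; ring.
have : (X - U) * (X - V) = 0.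
  apply: (mulfI char3_two_neq0); rewrite mulr0.
  have -> : 2 * ((X - U) * (X - V)) = X ^+ 2 + Y ^+ 2 - (U ^+ 2 + V ^+ 2) by rewrite YE; ring.
  by rewrite e2 subrr.
move=> /eqP; rewrite mulf_eq0 !subr_eq0 YE => /orP[/eqP ->|/eqP ->].
  by left; split; ring.
by right; split; ring.
Qed.

Lemma newton2 (X Y Z U V : F) : X + Y + Z = U + V ->
  X ^+ 2 + Y ^+ 2 + Z ^+ 2 = U ^+ 2 + V ^+ 2 -> X * Y + Y * Z + Z * X = U * V.
Proof.
move=> e1 p2; apply: (mulfI char3_two_neq0).
transitivity ((X + Y + Z) ^+ 2 - (X ^+ 2 + Y ^+ 2 + Z ^+ 2)); first by ring.
by rewrite e1 p2; ring.
Qed.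

(** Newton's formula p5 = e1^5 - 5 e1^3 e2 + 5 e1 e2^2 + 5 (e1^2 - e2) e3 on both sides: U, V form a
    triple with third entry 0, so only e3 differs. *)
Lemma newton5 (X Y Z U V : F) : X + Y + Z = U + V ->
  X * Y + Y * Z + Z * X = U * V ->
  X ^+ 5 + Y ^+ 5 + Z ^+ 5 =
  U ^+ 5 + V ^+ 5 + 5 * (X * Y * Z * ((U + V) ^+ 2 - U * V)).
Proof.
move=> e1 e2.
transitivity ((X + Y + Z) ^+ 5 - 5 * (X + Y + Z) ^+ 3 * (X * Y + Y * Z + Z * X)
  + 5 * (X + Y + Z) * (X * Y + Y * Z + Z * X) ^+ 2
  + 5 * (X + Y + Z) ^+ 2 * (X * Y * Z) - 5 * (X * Y + Y * Z + Z * X) * (X * Y * Z)).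
  by ring.
by rewrite e1 e2; ring.
Qed.

(** Here e2 = 0, and [newton5] leaves 5 e3 W^2 = 0. If W is nonzero, e2 = e3 = 0 kills two of the
    three terms; if W = 0, then X, Y, Z are the roots of T^3 - e3, which has a single root in
    characteristic 3. *)
Lemma power_sums31 (X Y Z W : F) :
  X + Y + Z = W -> X ^+ 2 + Y ^+ 2 + Z ^+ 2 = W ^+ 2 -> X ^+ 5 + Y ^+ 5 + Z ^+ 5 = W ^+ 5 ->
  if W == 0 then X = Y /\ Y = Z else
  [\/ [/\ X = 0, Y = 0 & Z = W], [/\ X = 0, Z = 0 & Y = W] | [/\ Y = 0, Z = 0 & X = W]].
Proof.
move=> p1 p2 p5.
have p1' : X + Y + Z = W + 0 by rewrite addr0.
have p2' : X ^+ 2 + Y ^+ 2 + Z ^+ 2 = W ^+ 2 + 0 ^+ 2 by rewrite expr0n addr0.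
have e2 := newton2 p1' p2'; have := newton5 p1' e2.
rewrite p5 expr0n !mulr0 !addr0 subr0 in e2 *.
move/esym/eqP; rewrite -subr_eq0 addrC addKr mulf_eq0 (negPf char3_five_neq0) /=.
rewrite mulf_eq0 orbC expf_eq0 /=.
case: eqVneq => [W0 _|W0 /= /eqP e3].
  have ZE : Z = - X - Y.
    by transitivity (X + Y + Z - X - Y); [ring | rewrite p1 W0 sub0r].
  have : (X - Y) ^+ 2 == 0.
    have -> : (X - Y) ^+ 2 = - (X * Y + Y * Z + Z * X) - 3 * (X * Y) by rewrite ZE; ring.
    by rewrite e2 three0 mul0r oppr0 addr0.
  rewrite expf_eq0 /= subr_eq0 => /eqP XY; split=> //.
  rewrite ZE XY; transitivity (3 * Y - Y - Y); first by ring.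
  by rewrite three0; ring.
move/eqP: e3; rewrite !mulf_eq0 -orbA => /or3P[] /eqP v0; rewrite v0 in e2 p1 *.
- move/eqP: e2; rewrite mul0r mulr0 add0r addr0 mulf_eq0 => /orP[]/eqP v1; rewrite v1 in p1 *.
    by constructor 1; split=> //; rewrite -p1; ring.
  by constructor 2; split=> //; rewrite -p1; ring.
- move/eqP: e2; rewrite mul0r mulr0 !add0r mulf_eq0 => /orP[]/eqP v1; rewrite v1 in p1 *.
    by constructor 3; split=> //; rewrite -p1; ring.
  by constructor 1; split=> //; rewrite -p1; ring.
- move/eqP: e2; rewrite mul0r mulr0 !addr0 mulf_eq0 => /orP[]/eqP v1; rewrite v1 in p1 *.
    by constructor 2; split=> //; rewrite -p1; ring.
  by constructor 3; split=> //; rewrite -p1; ring.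
Qed.

(* Heron's formula: in characteristic 3 the quartic e1^2 - e2 in the squares of
   x, y, z splits into the four lines z = +-x+-y. *)
Lemma heron_char3 (x y z : F) :
  (x ^+ 2 + y ^+ 2 + z ^+ 2) ^+ 2 - (x ^+ 2 * y ^+ 2 + y ^+ 2 * z ^+ 2 + z ^+ 2 * x ^+ 2)
  = (z ^+ 2 - (x + y) ^+ 2) * (z ^+ 2 - (x - y) ^+ 2).
Proof.
transitivity ((z ^+ 2 - (x + y) ^+ 2) * (z ^+ 2 - (x - y) ^+ 2)
  + 3 * (x ^+ 2 * y ^+ 2 + y ^+ 2 * z ^+ 2 + z ^+ 2 * x ^+ 2)); first by ring.
by rewrite three0 mul0r addr0.
Qed.

(** For the squares of x, y, z the product e3 is nonzero, so [newton5] forces e1^2 = e2. Read on u,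
    v, this is (u^2 - v^2)^2 = 0 in characteristic 3; read on x, y, z, it factors by
    [heron_char3]. *)
Lemma power_sums32 (x y z u v : F) : x * y * z != 0 ->
  [/\ x ^+ 2 + y ^+ 2 + z ^+ 2 = u ^+ 2 + v ^+ 2,
      x ^+ 4 + y ^+ 4 + z ^+ 4 = u ^+ 4 + v ^+ 4 &
      x ^+ 10 + y ^+ 10 + z ^+ 10 = u ^+ 10 + v ^+ 10] <->
  (z ^+ 2 = (x + y) ^+ 2 /\ u ^+ 2 = (x - y) ^+ 2 /\ v ^+ 2 = (x - y) ^+ 2) \/
  (z ^+ 2 = (x - y) ^+ 2 /\ u ^+ 2 = (x + y) ^+ 2 /\ v ^+ 2 = (x + y) ^+ 2).
Proof.
move=> xyz0.
have e3 : x ^+ 2 * y ^+ 2 * z ^+ 2 != 0 by rewrite -!exprMn expf_neq0.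
(* Once z lies on one pair of lines, e1 is minus the square attached to the other pair; [y'] will be
   [y] or [- y]. *)
have key (y' : F) : z ^+ 2 = (x + y') ^+ 2 -> x ^+ 2 + y' ^+ 2 + z ^+ 2 = - (x - y') ^+ 2.
  move=> ->; transitivity (3 * (x ^+ 2 + y' ^+ 2) - (x - y') ^+ 2); first by ring.
  by rewrite three0; ring.
have four n (w : F) : w ^+ (2 * n) = (w ^+ 2) ^+ n by rewrite exprM.
rewrite !(four 2%N) !(four 5%N).
split.
  case=> p1 p2 p5; have e2 := newton2 p1 p2; have := newton5 p1 e2.
  rewrite p5 => /esym/eqP; rewrite -subr_eq0 addrC addKr mulf_eq0 (negPf char3_five_neq0) /=.
  rewrite mulf_eq0 (negbTE e3) /= => /eqP s0.
  have uv : u ^+ 2 = v ^+ 2.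
    apply/eqP; rewrite -subr_eq0 -sqrf_eq0.
    have -> : (u ^+ 2 - v ^+ 2) ^+ 2 = ((u ^+ 2 + v ^+ 2) ^+ 2 - u ^+ 2 * v ^+ 2) - 3 * (u ^+ 2 * v ^+ 2) by ring.
    by rewrite s0 three0 mul0r subrr.
  (* Now e1 = 2 u^2 = - u^2. *)
  have uE : u ^+ 2 = - (x ^+ 2 + y ^+ 2 + z ^+ 2).
    rewrite p1 -uv; transitivity (- (u ^+ 2 + u ^+ 2) + 3 * u ^+ 2); first by ring.
    by rewrite three0 mul0r addr0.
  move/eqP: s0; rewrite -p1 -e2 heron_char3 mulf_eq0 !subr_eq0 => /orP[/eqP zE|/eqP zE]; [left|right];
    split=> //; rewrite -uv uE.
    by rewrite (key y) // opprK.
  have -> : y ^+ 2 = (- y) ^+ 2 by ring.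
  by rewrite (key (- y)) // !opprK.
move=> h.
have uv : u ^+ 2 = v ^+ 2 by case: h => [[_ [-> ->]]|[_ [-> ->]]].
have z0 : (z ^+ 2 - (x + y) ^+ 2) * (z ^+ 2 - (x - y) ^+ 2) = 0.
  by case: h => [[-> _]|[-> _]]; rewrite subrr ?mul0r ?mulr0.
have uE : u ^+ 2 = - (x ^+ 2 + y ^+ 2 + z ^+ 2).
  case: h => [[zE [-> _]]|[zE [-> _]]]; first by rewrite (key y) // opprK.
  have -> : y ^+ 2 = (- y) ^+ 2 by ring.
  by rewrite (key (- y)) // !opprK.
have p1 : x ^+ 2 + y ^+ 2 + z ^+ 2 = u ^+ 2 + v ^+ 2.
  rewrite -uv -[LHS]opprK -uE; transitivity (- u ^+ 2 + 3 * u ^+ 2); last by ring.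
  by rewrite three0 mul0r addr0.
have e2 : x ^+ 2 * y ^+ 2 + y ^+ 2 * z ^+ 2 + z ^+ 2 * x ^+ 2 = u ^+ 2 * v ^+ 2.
  have := heron_char3 x y z; rewrite z0 => /eqP; rewrite subr_eq0 => /eqP <-.
  by rewrite -uv uE; ring.
split=> //.
  transitivity ((x ^+ 2 + y ^+ 2 + z ^+ 2) ^+ 2 - 2 * (x ^+ 2 * y ^+ 2 + y ^+ 2 * z ^+ 2 + z ^+ 2 * x ^+ 2)).
    by ring.
  by rewrite p1 e2; ring.
rewrite (newton5 p1 e2) -p1 -e2 heron_char3 z0; ring.
Qed.

End PowerSums.

(** * Orthogonality of the additive characters *)

Section Character.
Set Implicit Arguments.
Unset Strict Implicit.

Variables (R : realType) (p m : nat) (F : finFieldType).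
Hypotheses (p_pr : prime p) (cardF : #|F| = (p ^ m)%N).

Let pcharF : p \in [pchar F] := card_finPcharP cardF p_pr.

Definition psi (x : F) : R[i] := zeta R p ^+ Tr p m x.

Lemma TrD (x y : F) : Tr p m (x + y) = Tr p m x + Tr p m y.
Proof.
apply: (natrFp_inj p_pr cardF) => /=; rewrite (TrP p_pr cardF).
have -> (k l : 'F_p) : (((k + l)%R : 'F_p) : nat)%:R = (k : nat)%:R + (l : nat)%:R :> F.
  have e := rmorphD (in_alg (pPrimeCharType pcharF)) k l.
  apply: etrans (esym (mulr1 _)) (etrans e _).
  by congr (_ + _); apply: mulr1.
rewrite !(TrP p_pr cardF) /conj_sum -big_split; apply: eq_bigr => i _ /=.
by rewrite exprDn_pchar // pnatX pnatE ?pcharF.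
Qed.

Lemma psiD x y : psi (x + y) = psi x * psi y.
Proof.
rewrite /psi TrD -exprD /= [X in _ ^+ (_ %% X)]Fp_cast //.
exact: expr_mod (zetaXp R p_pr).
Qed.

Lemma psi0 : psi 0 = 1.
Proof.
have := psiD 0 0; rewrite addr0 => e.
have z0 : psi 0 != 0.
  rewrite /psi expf_neq0 //; apply/eqP => z0; have := zetaXp R p_pr.
  by rewrite z0 expr0n gtn_eqF ?prime_gt0 // => /esym/eqP; rewrite oner_eq0.
by apply: (mulfI z0); rewrite mulr1.
Qed.

Lemma psi_conj x : (psi x)^*%C = psi (- x).
Proof.
have e : psi x * (psi x)^*%C = 1.
  by rewrite /psi rmorphXn /= -exprMn conj_zeta expr1n.
have n0 : psi x != 0 by apply/eqP => z; move/eqP: e; rewrite z mul0r eq_sym oner_eq0.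
by apply: (mulfI n0); rewrite e -psiD subrr psi0.
Qed.

(** Frobenius permutes the conjugates cyclically, because x^(p^m) = x; so the trace is unchanged. *)
Lemma psi_frob x : psi (x ^+ p) = psi x.
Proof.
congr (_ ^+ _); congr (nat_of_ord _).
apply: (natrFp_inj p_pr cardF) => /=; rewrite !(TrP p_pr cardF) /conj_sum.
case: (m) cardF => [|n] cF; first by rewrite !big_ord0.
rewrite big_ord_recr big_ord_recl /= expn0 expr1 addrC -exprM -expnS -cF expf_card.
by congr (_ + _); apply: eq_bigr => i _; rewrite -exprM -expnS.
Qed.

(** With th = pi / p strictly between 0 and pi, cos (2 th) = 1 would give sin th = 0. *)
Lemma zeta_neq1 : zeta R p != 1.
Proof.
have p_gt0 : 0 < p%:R :> R by rewrite ltr0n prime_gt0.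
set th : R := pi / p%:R.
have sth : 0 < sin th.
  apply: sin_gt0_pi; rewrite divr_gt0 ?pi_gt0 //=.
  by rewrite ltr_pdivrMr // ltr_pMr ?pi_gt0 // ltr1n prime_gt1.
apply/eqP => /(congr1 (@complex.Re R)) /=.
have -> : 2 * pi / p%:R = th *+ 2 :> R by rewrite -mulrA mulr_natl.
rewrite cos_mulr2n => e; have := cos2Dsin2 th.
have := exprn_gt0 2 sth; lra.
Qed.

(** The trace polynomial is nonzero of degree at most p^(m-1), so some x has nonzero trace. That
    trace is coprime to p, and a Bezout relation would turn [psi x = 1] into [zeta R p = 1]. *)
Lemma exists_psi_neq1 : exists x, psi x != 1.
Proof.
have [x Trx] : exists x : F, Tr p m x != 0 :> 'F_p.
  apply/existsP; apply: contraT; rewrite negb_exists => /forallP /= h.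
  (* For m = 0 the field would have a single element. *)
  have m_gt0 : (0 < m)%N.
    case: (m) cardF => // cF; have := finRing_gt1 F; by rewrite cF.
  pose P : {poly F} := \sum_(i < m) 'X^(p ^ i).
  have rP x : root P x.
    rewrite /root /P horner_sum; have /negPn/eqP tx := h x.
    have := TrP p_pr cardF x; rewrite tx /= /conj_sum => e.
    by under eq_bigr do rewrite hornerXn; rewrite -e.
  have P0 : P != 0.
    apply/eqP => /(congr1 (fun Q : {poly F} => Q`_1)); rewrite coef0 /P coef_sum.
    rewrite (bigD1 (Ordinal m_gt0)) //= big1 ?addr0 => [|i i0].
      by rewrite expn0 coefXn eqxx => /eqP; rewrite oner_eq0.
    rewrite coefXn eq_sym -(expn0 p) eqn_exp2l ?prime_gt1 //.
    by have -> : (i == 0 :> nat)%N = false by apply: negbTE.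
  have sP : (size P <= (p ^ m.-1).+1)%N.
    apply: (leq_trans (size_sum _ _ _)); apply/bigmax_leqP => i _.
    by rewrite size_polyXn ltnS leq_exp2l ?prime_gt1 // -ltnS prednK.
  have := max_poly_roots P0 (introT allP (fun x _ => rP x)) (enum_uniq F).
  rewrite -cardE cardF -[X in (_ ^ X)%N](prednK m_gt0) => /leq_trans/(_ sP).
  by rewrite ltnS leq_exp2l ?prime_gt1 // ltnn.
exists x; apply: contra zeta_neq1 => /eqP zx1.
have cop : coprime (Tr p m x) p.
  rewrite coprime_sym prime_coprime // gtnNdvd //; first by rewrite lt0n.
  by rewrite -[X in (_ < X)%N](Fp_cast p_pr) ltn_ord.
have t_gt0 : (0 < Tr p m x)%N by rewrite lt0n.
case: (egcdnP p t_gt0) => u v e _; move: e; rewrite (eqP cop) => e.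
have := congr1 (fun n => zeta R p ^+ n) e.
rewrite /= mulnC exprM -/(psi x) zx1 expr1n exprD mulnC exprM (zetaXp R p_pr).
by rewrite expr1n mul1r expr1 => <-.
Qed.

(** For c nonzero, the shift by x0 / c multiplies the sum by [psi x0], which is not 1. *)
Lemma sum_psi c : \sum_x psi (c * x) = (#|F| * (c == 0))%:R.
Proof.
have [->|c0] := eqVneq c 0.
  under eq_bigr do rewrite mul0r psi0.
  by rewrite sumr_const muln1.
have [x0 psix0] := exists_psi_neq1.
have e : psi x0 * (\sum_x psi (c * x)) = \sum_x psi (c * x).
  rewrite mulr_sumr [RHS](reindex_inj (addIr (x0 / c))) /=; apply: eq_bigr => x _.
  by rewrite -psiD mulrDr (mulrC c (_ / _)) divfK // addrC.
rewrite muln0; apply/eqP; have /eqP := e.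
rewrite -subr_eq0 -{2}[\sum_x _]mul1r -mulrBl mulf_eq0 subr_eq0.
by rewrite (negbTE psix0).
Qed.

(** Allowing any finite family of points keeps products and conjugates in the same shape: a product
    is indexed by pairs, and conjugation negates the family. Each moment of S is then a sum over t
    of one such character sum. *)
Definition charsum (I : finType) (f : I -> F * F * F) (t : F * F * F) : R[i] :=
  \sum_i psi (t.1.1 * (f i).1.1 + t.1.2 * (f i).1.2 + t.2 * (f i).2).

Lemma charsumM (I J : finType) (f : I -> F * F * F) (g : J -> F * F * F) t :
  charsum f t * charsum g t = charsum (fun ij : I * J => f ij.1 + g ij.2) t.
Proof.
rewrite /charsum big_distrlr /= pair_bigA; apply: eq_bigr => -[i j] _ /=.
by rewrite -psiD; congr psi; ring.
Qed.

Lemma charsum_conj (I : finType) (f : I -> F * F * F) t :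
  (charsum f t)^*%C = charsum (fun i => - f i) t.
Proof.
rewrite /charsum rmorph_sum; apply: eq_bigr => i _ /=.
by rewrite psi_conj; congr psi; ring.
Qed.

(** Summing over the three coordinates of t separately gives three orthogonality relations, which
    together single out the zeros of the family. *)
Lemma sum_charsum (I : finType) (f : I -> F * F * F) :
  \sum_t charsum f t = (#|F| ^ 3 * \sum_i (f i == 0%R))%:R.
Proof.
rewrite /charsum exchange_big /= big_distrr natr_sum; apply: eq_bigr => i _ /=.
case: (f i) => [[u v] w] /=.
transitivity (\sum_(a : F) \sum_(b : F) \sum_(c : F) psi (u * a) * psi (v * b) * psi (w * c)).
  rewrite [RHS]pair_bigA [RHS]pair_bigA; apply: eq_bigr => -[[a b] c] _ /=.
  by rewrite -!psiD (mulrC a) (mulrC b) (mulrC c).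
under eq_bigr do under eq_bigr do rewrite -mulr_sumr.
under eq_bigr do rewrite -mulr_suml -mulr_sumr.
rewrite -mulr_suml -mulr_suml !sum_psi -!natrM; congr _%:R.
have -> : ((u, v, w) == 0) = (u == 0) && (v == 0) && (w == 0) by [].
by case: (u == 0); case: (v == 0); case: (w == 0); rewrite ?muln0 ?mul0n ?muln1 //=; ring.
Qed.

End Character.

(** * The radical of the quadratic form *)

Section Radical.
Set Implicit Arguments.
Unset Strict Implicit.

Variables (R : realType) (m : nat) (F : finFieldType).
Hypothesis cardF : #|F| = (3 ^ m)%N.

Let pr3 : prime 3 := isT.
Local Notation psi := (psi R 3 m).
Local Notation S := (charsum R 3 m).

Lemma three_eq0 : 3 = 0 :> F.
Proof. by have /andP[_ /eqP] := card_finPcharP cardF pr3. Qed.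

Lemma cubeD (x y : F) : (x + y) ^+ 3 = x ^+ 3 + y ^+ 3.
Proof. ring: three_eq0. Qed.

Lemma ninthD (x y : F) : (x + y) ^+ 9 = x ^+ 9 + y ^+ 9.
Proof. by rewrite (exprM _ 3 3) cubeD cubeD -!exprM. Qed.

Lemma psi9 (x : F) : psi (x ^+ 9) = psi x.
Proof. by rewrite (exprM _ 3 3) !psi_frob. Qed.

Definition powers (x : F) : F * F * F := (x ^+ 2, x ^+ 4, x ^+ 10).

Definition form (t : F * F * F) (x : F) : F :=
  t.1.1 * x ^+ 2 + t.1.2 * x ^+ 4 + t.2 * x ^+ 10.

(* [psi (radpoly t h * y ^+ 9)] is the polarization of [psi \o form t]: raising
   the conjugates of its terms to powers of 3 makes them all linear in y ^ 9. *)
Definition radpoly (t : F * F * F) (h : F) : F :=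
  t.2 * h + t.1.2 ^+ 3 * h ^+ 3 + 2 * t.1.1 ^+ 9 * h ^+ 9 + t.1.2 ^+ 9 * h ^+ 27
  + t.2 ^+ 9 * h ^+ 81.

Lemma radpolyD t : {morph radpoly t : x y / x + y}.
Proof.
move=> x y; rewrite /radpoly (exprM _ 9 3) (exprM _ 9 9) !(cubeD, ninthD).
by rewrite -!exprM /=; ring.
Qed.

Lemma form_polar t y h :
  psi (form t (y + h) - form t y) = psi (form t h) * psi (radpoly t h * y ^+ 9).
Proof.
case: t => [[al be] ga]; rewrite -(psiD R pr3 cardF) /form /radpoly /=.
have -> : (y + h) ^+ 4 = (y + h) * (y ^+ 3 + h ^+ 3) by rewrite exprS cubeD.
have -> : (y + h) ^+ 10 = (y + h) * (y ^+ 9 + h ^+ 9) by rewrite exprS ninthD.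
transitivity (psi (al * h ^+ 2 + be * h ^+ 4 + ga * h ^+ 10
   + ga * h * y ^+ 9 + be * h * y ^+ 3 + 2 * al * h * y + be * h ^+ 3 * y + ga * h ^+ 9 * y)).
  by congr psi; ring.
(* 2 lies in the prime field, hence equals its ninth power: 512 = 2 + 3 * 170. *)
have two9 : 2 ^+ 9 = 2 :> F.
  have -> : 2 ^+ 9 = 2 + 3 * 170 :> F by ring.
  by rewrite three_eq0 mul0r addr0.
rewrite !(psiD R pr3 cardF) -(psi_frob R pr3 cardF (be * h * _)) -(psi9 (2 * _ * _ * _)).
rewrite -(psi9 (be * h ^+ 3 * _)) -(psi9 (ga * h ^+ 9 * _)) -!(psiD R pr3 cardF).
by congr psi; rewrite !exprMn two9; ring.
Qed.

Lemma sum_psi9 (c : F) : \sum_x psi (c * x ^+ 9) = (#|F| * (c == 0))%:R.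
Proof.
rewrite -(sum_psi R pr3 cardF) [RHS](reindex_inj (h := fun x : F => x ^+ 9)) //=.
move=> x y /eqP; rewrite -subr_eq0 => /eqP e; apply/eqP; rewrite -subr_eq0.
suff : (x - y) ^+ 9 == 0 by rewrite expf_eq0.
have -> : (x - y) ^+ 9 = x ^+ 9 - y ^+ 9 by rewrite ninthD; congr (_ + _); ring.
by apply/eqP.
Qed.

(** Take y = h in [form_polar]: in characteristic 3, h + h = - h, and the form is even, so the left
    side is [psi 0]. *)
Lemma psi_form_rad t h : radpoly t h = 0 -> psi (form t h) = 1.
Proof.
move=> L0; have := form_polar t h h; rewrite L0 mul0r (psi0 R pr3 cardF) mulr1.
have -> : h + h = - h by transitivity (3 * h - h); [ring | rewrite three_eq0; ring].
have -> : form t (- h) = form t h. by rewrite /form; ring.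
by rewrite subrr (psi0 R pr3 cardF).
Qed.

(** After the shift by y, [form_polar] makes the sum over y vanish unless h is in the radical, where
    the remaining factor [psi (form t h)] is 1. *)
Lemma charsum_norm t :
  S powers t * (S powers t)^*%C = (#|F| * #|[set h | radpoly t h == 0]|)%:R.
Proof.
rewrite (charsum_conj R pr3 cardF) /charsum mulr_suml.
transitivity (\sum_y \sum_h psi (form t (y + h) - form t y)).
  under eq_bigr do rewrite mulr_sumr.
  rewrite exchange_big; apply: eq_bigr => y _ /=.
  rewrite (reindex_inj (addrI y)); apply: eq_bigr => h _ /=.
  by rewrite -(psiD R pr3 cardF) !mulrN -!opprD.
rewrite exchange_big /= natrM -(sum1_card (mem [set h | _])) natr_sum mulr_sumr.
rewrite [RHS]big_mkcond; apply: eq_bigr => h _ /=.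
under eq_bigr do rewrite form_polar.
rewrite -mulr_sumr sum_psi9 inE; case: eqP => [/psi_form_rad ->|_].
  by rewrite muln1 mul1r mulr1.
by rewrite muln0 mulr0.
Qed.

(** The radical is a subgroup of an additive group of order 3^m, so its order is a power of 3; it
    consists of roots of a nonzero polynomial of degree at most 81 = 3^4. *)
Lemma card_radical t : t != 0 ->
  exists2 j, (j <= 4)%N & #|[set h | radpoly t h == 0]| = (3 ^ j)%N.
Proof.
move=> t0; set K := [set h | _].
have gK : group_set K.
  apply/group_setP; split; first by rewrite inE /= /radpoly !(expr0n, mulr0, addr0) /=.
  by move=> x y; rewrite !inE radpolyD => /eqP -> /eqP ->; rewrite addr0.
have : (#|K| %| 3 ^ m)%N.
  by have := cardSg (subsetT (Group gK)); rewrite cardsT cardF.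
case/dvdn_pfactor => // j _ cK; exists j => //.
rewrite -(leq_exp2l (m := 3)) // -cK.
pose P := t.2 *: 'X + t.1.2 ^+ 3 *: 'X^3 + (2 * t.1.1 ^+ 9) *: 'X^9
  + t.1.2 ^+ 9 *: 'X^27 + t.2 ^+ 9 *: 'X^81.
have P0 : P != 0.
  apply: contra t0 => /eqP P0.
  have cP i : P`_i = 0 by rewrite P0 coef0.
  (* The coefficients in degrees 1, 3 and 9 already force the three coordinates of t to vanish. *)
  have := (cP 1, cP 3, cP 9)%N; rewrite /P !coefE /= !(mulr0, mulr1, addr0, add0r).
  case=> [[/eqP ga0] /eqP be0] /eqP; rewrite mulf_eq0 expf_eq0 /= => /orP[|al0].
    by move=> /eqP two0; have := three_eq0; rewrite -[3]/(1 + 2)%:R natrD two0 addr0 => /eqP; rewrite oner_eq0.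
  rewrite expf_eq0 /= in be0.
  by case: t ga0 be0 al0 {K gK cK P P0 cP} => [[al be] ga] /= /eqP -> /eqP -> /eqP ->.
have sP : (size P <= 82)%N.
  apply/leq_sizeP => i le_i; rewrite /P !coefE.
  do 5![rewrite gtn_eqF ?(leq_trans _ le_i) //]; by rewrite !mulr0 !addr0.
have rP : all (root P) (enum K).
  apply/allP => h; rewrite mem_enum inE => /eqP e; apply/eqP.
  by rewrite /P !(hornerD, hornerZ, hornerXn, hornerX).
by have := leq_trans (max_poly_roots P0 rP (enum_uniq _)) sP; rewrite -cardE ltnS.
Qed.

End Radical.

(** * Values of the exponential sum *)

Arguments powers {F} x.

Section Values.
Set Implicit Arguments.
Unset Strict Implicit.

(** Descent: 3 divides A, and A = 3 A1 leaves B^2 + 3 A1^2 = 3^(k-1) with the roles exchanged,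
    whence the alternating sign. For theta^2 = -3, the two conclusions say that (A + B theta)^2 =
    (-3)^k. *)
Lemma norm_form_pow3 k (A B : int) : A ^+ 2 + 3 * B ^+ 2 = 3 ^+ k ->
  A * B = 0 /\ A ^+ 2 - 3 * B ^+ 2 = (- 3) ^+ k.
Proof.
elim: k A B => [|k IHk] A B; rewrite ?expr0 => e.
  have B0 : B = 0 by move: e; rewrite !expr2; nia.
  by split; [rewrite B0 mulr0 | move: e; rewrite B0 !expr2; lia].
have /dvdzP [A1 A1E] : (3 %| A)%Z.
  have : (3 %| A ^+ 2)%Z.
    have -> : A ^+ 2 = (3 ^+ k - B ^+ 2) * 3 by rewrite -[A ^+ 2](addrK (3 * B ^+ 2)) e exprS; ring.
    exact: dvdz_mull.
  by rewrite !dvdzE abszX Euclid_dvdX // andbT.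
have /IHk[AB0 IH] : B ^+ 2 + 3 * A1 ^+ 2 = 3 ^+ k by apply: (mulfI (_ : 3 != 0)); rewrite // -exprS -e A1E; ring.
split; first by rewrite A1E mulrAC (mulrC A1) AB0 mul0r.
by rewrite [RHS]exprS -IH A1E; ring.
Qed.

(** Squaring is two-to-one from the nonzero elements onto the nonzero squares. This provides the
    shape S = 1 + 2 w. *)
Lemma sum_sqr (F : finFieldType) (V : nmodType) (f : F -> V) : 2 != 0 :> F ->
  \sum_x f (x ^+ 2) = f 0 + (\sum_(y | (y != 0) && [exists x, x ^+ 2 == y]) f y) *+ 2.
Proof.
move=> two0; rewrite (bigD1 0) //= expr0n /=; congr (_ + _).
rewrite (partition_big (fun x => x ^+ 2) (fun y => (y != 0) && [exists x, x ^+ 2 == y])) /=.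
  rewrite -sumrMnl; apply: eq_bigr => y /andP[y0 /existsP[x0 /eqP x0y]].
  have x00 : x0 != 0 by apply: contraNneq y0 => x00; rewrite -x0y x00 expr0n.
  rewrite (bigD1 x0) /= ?x00 ?x0y ?eqxx //.
  rewrite (bigD1 (- x0)) /= ?oppr_eq0 ?x00 ?sqrrN ?x0y ?eqxx //=.
    rewrite big1 ?addr0 // => x /andP[/andP[/andP[_ /eqP xy] /negbTE n1] /negbTE n2].
    by move/eqP: xy; rewrite -x0y eqf_sqr n1 n2.
  by rewrite eq_sym -addr_eq0 -mulr2n -mulr_natl mulf_neq0.
by move=> x x0; rewrite expf_neq0 //=; apply/existsP; exists x.
Qed.

Variables (R : realType) (m : nat) (F : finFieldType).
Hypothesis cardF : #|F| = (3 ^ m)%N.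

Let pr3 : prime 3 := isT.
Local Notation psi := (psi R 3 m).
Local Notation S := (charsum R 3 m).
Local Notation zeta := (zeta R 3).

Lemma conjcD (x y : R[i]) : (x + y)^*%C = x^*%C + y^*%C.
Proof. exact: rmorphD. Qed.

Lemma conjcM (x y : R[i]) : (x * y)^*%C = x^*%C * y^*%C.
Proof. exact: rmorphM. Qed.

Lemma conjc_int (n : int) : (n%:~R : R[i])^*%C = n%:~R.
Proof. exact: rmorph_int. Qed.

(** This is i sqrt 3, the quadratic Gauss sum modulo 3. *)
Definition theta : R[i] := zeta - zeta ^+ 2.

Lemma zeta_quadratic : zeta ^+ 2 = - 1 - zeta.
Proof.
have : (zeta - 1) * (zeta ^+ 2 + zeta + 1) = 0.
  have -> : (zeta - 1) * (zeta ^+ 2 + zeta + 1) = zeta ^+ 3 - 1 by ring.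
  by rewrite zetaXp // subrr.
move/eqP; rewrite mulf_eq0 subr_eq0 (negbTE (zeta_neq1 R pr3)) /= => /eqP e.
by rewrite -[LHS]subr0 -e; ring.
Qed.

Lemma sqr_theta : theta ^+ 2 = - 3.
Proof.
have e := zeta_quadratic; rewrite /theta e.
have -> : (zeta - (- 1 - zeta)) ^+ 2 = 4 * zeta ^+ 2 + 4 * zeta + 1 by ring.
by rewrite e; ring.
Qed.

Lemma conj_theta : theta^*%C = - theta.
Proof.
have zc : zeta^*%C = zeta ^+ 2.
  have z0 : zeta != 0 by apply/eqP=> z0; have := zetaXp R pr3; rewrite z0 expr0n /= => /esym/eqP; rewrite oner_eq0.
  by apply: (mulfI z0); rewrite conj_zeta -exprS zetaXp.
have -> : theta^*%C = zeta^*%C - zeta^*%C ^+ 2 by rewrite /theta rmorphB rmorphXn.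
by rewrite zc -exprM (exprS _ 3) zetaXp // /theta; ring.
Qed.

(* The factor 2 is what keeps A and B integral: without the evenness of the form
   they would only be half-integers, as for the units zeta and zeta ^+ 2. *)
Lemma charsum_powers_int (t : F * F * F) :
  exists A B : int, S powers t = A%:~R + B%:~R * theta.
Proof.
pose g (y : F) := psi (t.1.1 * y + t.1.2 * y ^+ 2 + t.2 * y ^+ 5).
have -> : S powers t = \sum_x g (x ^+ 2).
  by apply: eq_bigr => x _; rewrite /g /= -!exprM.
rewrite sum_sqr ?(char3_two_neq0 (three_eq0 cardF)) //.
have [a [b ->]] : exists a b : int,
    \sum_(y | (y != 0) && [exists x, x ^+ 2 == y]) g y = a%:~R + b%:~R * zeta.
  elim/big_ind: _ => [|_ _ [a [b ->]] [c [d ->]]|y _].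
  - by exists 0, 0; rewrite mul0r addr0.
  - by exists (a + c), (b + d); rewrite !intrD; ring.
  - rewrite /g /psi; case: (Tr _ _ _) => [[|[|[|n]]]] //= _.
    + by exists 1, 0; rewrite mul0r addr0.
    + by exists 0, 1; rewrite mul1r add0r.
    + by exists (- 1), (- 1); rewrite zeta_quadratic mulN1r.
have -> : g 0 = 1 by rewrite /g !(mulr0, expr0n, addr0) psi0.
(* Since theta = 1 + 2 zeta, one has 1 + 2 (a + b zeta) = (1 + 2 a - b) + b theta. *)
exists (1 + 2 * a - b), b.
by rewrite /theta zeta_quadratic !(intrD, intrN, intrM); ring.
Qed.

Local Notation val := (expsum_value R 3 m).

Lemma expsum_value_neq0 eps j : eps != 0 -> val eps j != 0.
Proof.
move=> eps0; rewrite /expsum_value !mulf_neq0 ?intr_eq0 //.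
  by case: odd; rewrite ?oner_eq0 // neq0Ci.
by rewrite fmorph_eq0 gt_eqF // powR_gt0.
Qed.

(** As m is even, the factor i^2 = -1 present for odd j is exactly the sign of (-3)^(m+j). *)
Lemma sqr_expsum_value eps j : ~~ odd m ->
  val eps j ^+ 2 = eps%:~R ^+ 2 * (- 3) ^+ (m + j).
Proof.
move=> m_even; rewrite /expsum_value !exprMn -mulrA; congr (_ * _).
rewrite -rmorphXn /= -powR_mulrn ?powR_ge0 // -powRrM divfK ?pnatr_eq0 //.
rewrite powR_mulrn // rmorphXn /= -[- 3]mulN1r exprMn -signr_odd oddD (negbTE m_even) /=.
congr (_ * _); last by rewrite rmorph_nat.
by case: odd; rewrite ?expr1n // sqr_i.
Qed.

Lemma conj_expsum_value eps j : (val eps j)^*%C = (-1) ^+ j * val eps j.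
Proof.
rewrite /expsum_value -signr_odd !conjcM conjc_int.
have -> : (if odd j then 'i%C else 1 : R[i])^*%C = (-1) ^+ odd j * (if odd j then 'i%C else 1 : R[i]).
  case: odd; last by rewrite mul1r; exact: rmorph1.
  by apply/eqP; rewrite eq_complex /= !(mul1r, mulN1r, mul0r, oppr0, subr0, add0r, addr0) !eqxx.
by rewrite conjc_real !mulrA (mulrC eps%:~R).
Qed.

Lemma expsum_valueN j : val (-1) j = - val 1 j.
Proof. by rewrite /expsum_value rmorphN mulN1r mul1r mulNr. Qed.

Hypothesis m_even : ~~ odd m.

(** By [norm_form_pow3], S^2 = A^2 - 3 B^2 + 2 A B theta reduces to (-3)^(m+j), the square of the
    listed value of index j; so S is that value up to sign. *)
Lemma charsum_powers_value (t : F * F * F) : t != 0 ->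
  exists j : 'I_5, S powers t = val 1 j \/ S powers t = val (-1) j.
Proof.
move=> t0; have [j j4 cK] := card_radical cardF t0.
have [A [B SE]] := charsum_powers_int t.
have nS := charsum_norm R cardF t.
have e : A ^+ 2 + 3 * B ^+ 2 = 3 ^+ (m + j).
  apply: (@intr_inj R[i]); move: nS; rewrite cK cardF SE conjcD conjcM conj_theta !conjc_int -expnD natrX.
  rewrite intrD intrM !rmorphXn /= => <-.
  transitivity (A%:~R ^+ 2 - (- 3) * B%:~R ^+ 2 : R[i]); first by ring.
  by rewrite -sqr_theta; ring.
have [AB0 eN] := norm_form_pow3 e.
exists (Ordinal (j4 : (j < 5)%N)); rewrite expsum_valueN /=.
have : S powers t ^+ 2 == val 1 j ^+ 2.
  rewrite sqr_expsum_value // expr1n mul1r SE.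
  have /(congr1 (intr : int -> R[i])) := eN; rewrite [RHS]rmorphXn /= rmorphN /= => <-.
  have AB0' : A%:~R * B%:~R = 0 :> R[i] by rewrite -intrM AB0.
  apply/eqP; transitivity (A%:~R ^+ 2 + 2 * (A%:~R * B%:~R) * theta + B%:~R ^+ 2 * theta ^+ 2); first by ring.
  by rewrite AB0' sqr_theta intrD intrN intrM !rmorphXn /=; ring.
by rewrite eqf_sqr => /orP[/eqP|/eqP]; [left|right].
Qed.

Lemma expsum_value_inj j k : val 1 j ^+ 2 = val 1 k ^+ 2 -> j = k.
Proof.
rewrite !sqr_expsum_value // expr1n !mul1r => /(congr1 Num.norm).
rewrite !normrX normrN (ger0_norm (ler0n _ 3)) => /ieexprIn e.
by apply: (@addnI m); apply: e; rewrite ?ltr0n ?pnatr_eq1.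
Qed.

(** Each nonzero t falls into exactly one of ten classes: opposite values differ because they are
    nonzero, and values of distinct index have distinct squares. Sums over t thus become linear
    forms in the counts. *)
Lemma sum_by_value (f : R[i] -> R[i]) :
  \sum_(t : F * F * F | t != 0) f (S powers t) =
  \sum_(j < 5) ((nval R 3 m F 1 j)%:R * f (val 1 j) + (nval R 3 m F (-1) j)%:R * f (val (-1) j)).
Proof.
(* For p = 3 the exponents p + 1 and p^2 + 1 evaluate to 4 and 10, so [expsum] and [S powers] agree
   by computation. *)
have nvalE eps j : (nval R 3 m F eps j)%:R = \sum_(t : F * F * F | t != 0) (S powers t == val eps j)%:R :> R[i].
  rewrite /nval -sum1_card natr_sum big_mkcond [RHS]big_mkcond /=.
  by apply: eq_bigr => -[[a b] c] _; rewrite inE /=; case: (_ != _); case: (_ == _).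
under [RHS]eq_bigr do rewrite !nvalE !mulr_suml -big_split.
rewrite exchange_big /=; apply: eq_bigr => t t0.
have [j Sj] := charsum_powers_value t0.
rewrite (bigD1 j) //= big1 ?addr0 => [|k kj].
  have v0 : val 1 j != 0 by apply: expsum_value_neq0.
  have vv : val 1 j == - val 1 j = false.
    by rewrite -addr_eq0 -mulr2n -mulr_natl mulf_eq0 pnatr_eq0 (negbTE v0).
  by case: Sj => ->; rewrite !expsum_valueN ?[- _ == _]eq_sym vv eqxx !mul0r mul1r ?addr0 ?add0r.
have nk : (S powers t ^+ 2 == val 1 k ^+ 2) = false.
  apply: contraNF kj => /eqP e; apply/eqP/val_inj/esym/expsum_value_inj; rewrite -e.
  by case: Sj => ->; rewrite ?expsum_valueN ?sqrrN.
move: nk; rewrite eqf_sqr expsum_valueN => /negbT; rewrite negb_or => /andP[/negbTE -> /negbTE ->].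
by rewrite !mul0r addr0.
Qed.

End Values.

(** * Counting solutions *)

Section Counting.
Set Implicit Arguments.
Unset Strict Implicit.

Variable F : finFieldType.
Hypothesis three0 : 3 = 0 :> F.

Local Notation ind b := ((nat_of_bool b)%:R : int).
Local Notation q := (#|F|%:R : int).

Lemma indN (b : bool) : ind (~~ b) = 1 - ind b.
Proof. by case: b; rewrite ?subrr ?subr0. Qed.

Lemma sum_cst (k : int) : \sum_(x : F) k = q * k.
Proof. by rewrite sumr_const mulr_natl. Qed.

Lemma sum_ind (a : F) (f : F -> int) : \sum_x ind (x == a) * f x = f a.
Proof.
rewrite (bigD1 a) //= eqxx mul1r big1 ?addr0 // => x /negbTE ->.
by rewrite mul0r.
Qed.

Lemma sum_ind1 (a : F) : \sum_x ind (x == a) = 1.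
Proof. by rewrite -[RHS](sum_ind a (fun=> 1)); apply: eq_bigr => x _; rewrite mulr1. Qed.

Lemma eq_oppr (a : F) : (a == - a) = (a == 0).
Proof.
rewrite -addr_eq0 -mulr2n -mulr_natl mulf_eq0.
by rewrite (negPf (char3_two_neq0 three0)).
Qed.

(** The roots a and -a coincide at a = 0; the factor [ind (a != 0)] prevents counting 0 twice. *)
Lemma sum_ind_sqr (a : F) (f : F -> int) :
  \sum_x ind (x ^+ 2 == a ^+ 2) * f x = f a + ind (a != 0) * f (- a).
Proof.
transitivity (\sum_x (ind (x == a) * f x + ind (x == - a) * (ind (a != 0) * f x))).
  apply: eq_bigr => x _; rewrite eqf_sqr; have [->|xa] /= := eqVneq x a.
    rewrite eq_oppr mul1r.
    by case: (a == 0); rewrite ?mul0r ?mulr0 addr0.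
  rewrite mul0r add0r; have [xa'|] := eqVneq x (- a); last by rewrite !mul0r.
  have [a0|//] := eqVneq a 0; last by rewrite !mul1r.
  by move: xa; rewrite xa' a0 oppr0 eqxx.
by rewrite big_split /= !sum_ind.
Qed.

(** The number of square roots of a^2, not of a. *)
Definition nroots (a : F) : int := 2 - ind (a == 0).

Lemma sum_ind_sqr1 (a : F) : \sum_x ind (x ^+ 2 == a ^+ 2) = nroots a.
Proof.
transitivity (\sum_x ind (x ^+ 2 == a ^+ 2) * 1); first by apply: eq_bigr => x _; rewrite mulr1.
by rewrite sum_ind_sqr indN /nroots; ring.
Qed.

Lemma sum_nroots : \sum_x nroots x = 2 * q - 1.
Proof. by rewrite /nroots sumrB sum_cst sum_ind1; ring. Qed.

Lemma powers0 : powers (0 : F) = 0.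
Proof. by rewrite /powers !expr0n. Qed.

(** The two digits in the names of the counts are the numbers of terms with a plus and with a minus
    sign, that is, of plain and conjugated factors in the moment. *)
Lemma count10 : \sum_(x : F) ind (powers x == 0) = 1.
Proof.
rewrite -[RHS](sum_ind1 (0 : F)); apply: eq_bigr => x _; congr (nat_of_bool _)%:R.
have -> : (powers x == 0) = [&& x ^+ 2 == 0, x ^+ 4 == 0 & x ^+ 10 == 0] by rewrite andbA.
by rewrite !expf_eq0 /= !andbb.
Qed.

Lemma count20 : \sum_(x : F) \sum_(y : F) ind (powers x + powers y == 0) = 1.
Proof.
rewrite -[RHS](sum_ind1 (0 : F)); apply: eq_bigr => x _.
rewrite -[RHS](sum_ind (0 : F) (fun=> ind (x == 0))); apply: eq_bigr => y _.
rewrite -natrM mulnb; congr (nat_of_bool _)%:R; apply/idP/andP; last first.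
  by case=> /eqP -> /eqP ->; rewrite /powers !expr0n addr0.
have -> : (powers x + powers y == 0) = [&& x ^+ 2 + y ^+ 2 == 0, x ^+ 4 + y ^+ 4 == 0 & x ^+ 10 + y ^+ 10 == 0] by rewrite andbA.
case/and3P=> /eqP p1 /eqP p2 _.
have := @power_sums2 _ three0 (x ^+ 2) (y ^+ 2) 0 0; rewrite -!exprM expr0n addr0.
by case=> // -[/eqP + /eqP]; rewrite !expf_eq0 /= => -> ->.
Qed.

Lemma count11 : \sum_(x : F) \sum_(y : F) ind (powers x - powers y == 0) = 2 * q - 1.
Proof.
rewrite -[RHS]sum_nroots; apply: eq_bigr => x _; rewrite -sum_ind_sqr1; apply: eq_bigr => y _.
rewrite subr_eq0 eq_sym; congr (nat_of_bool _)%:R; apply/eqP/eqP => [[//]|e].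
by rewrite /powers !(exprM _ 2 2) !(exprM _ 2 5) e.
Qed.

(** By [power_sums2] with a zero fourth term, x or y vanishes and the other one is z up to sign; the
    subtracted product corrects the double count at x = y = 0. *)
Lemma count21 : \sum_(x : F) \sum_(y : F) \sum_(z : F) ind (powers x + powers y - powers z == 0) = 4 * q - 3.
Proof.
transitivity (\sum_x \sum_y (ind (y == 0) * nroots x + ind (x == 0) * nroots y - ind (y == 0) * ind (x == 0))).
  apply: eq_bigr => x _; apply: eq_bigr => y _.
  rewrite -!sum_ind_sqr1 -[X in _ - X]mulr1 -[X in _ - _ * X](sum_ind1 (0 : F)) !mulr_sumr -big_split -sumrB.
  apply: eq_bigr => z _ /=; rewrite subr_eq0.
  have zz : (z == 0) = (z ^+ 2 == 0) by rewrite expf_eq0.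
  have -> : (powers x + powers y == powers z) = (y == 0) && (z ^+ 2 == x ^+ 2) || (x == 0) && (z ^+ 2 == y ^+ 2).
    apply/eqP/orP.
      move=> [p1 p2 _]; have := @power_sums2 _ three0 (x ^+ 2) (y ^+ 2) (z ^+ 2) 0.
      rewrite addr0 -!exprM expr0n addr0 => /(_ p1 p2)[[-> /eqP]|[/eqP + ->]].
        by rewrite expf_eq0 /= => ->; left; rewrite eqxx.
      by rewrite expf_eq0 /= => ->; right; rewrite eqxx.
    by case=> /andP[/eqP-> /eqP e]; rewrite /powers !(exprM _ 2 2) !(exprM _ 2 5) e
      !expr0n /=; congr (_, _, _) => /=; rewrite ?addr0 ?add0r.
  have [->|y0] := eqVneq y 0; have [->|x0] := eqVneq x 0; rewrite ?mul0r ?mul1r ?expr0n ?zz /=;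
    by case: (z ^+ 2 == _); rewrite ?subr0 ?addr0 ?add0r ?addrK.
transitivity (\sum_x (nroots x + ind (x == 0) * (2 * q - 1) - ind (x == 0))).
  apply: eq_bigr => x _; rewrite sumrB big_split /= -mulr_sumr sum_nroots.
  by rewrite (sum_ind 0 (fun=> nroots x)) (sum_ind 0 (fun=> ind (x == 0))).
rewrite sumrB big_split /= sum_nroots (sum_ind 0 (fun=> _)) sum_ind1; ring.
Qed.

(** Inclusion-exclusion over the two ways to match z^2, w^2 with x^2, y^2, which coincide when x^2 =
    y^2. *)
Definition pair_roots (x y : F) : int :=
  2 * (nroots x * nroots y) - ind (y ^+ 2 == x ^+ 2) * nroots x ^+ 2.

Lemma sum_pair_roots (x y : F) :
  \sum_z \sum_w ind (powers x + powers y == powers z + powers w) = pair_roots x y.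
Proof.
transitivity (\sum_z \sum_w (ind (z ^+ 2 == x ^+ 2) * ind (w ^+ 2 == y ^+ 2)
  + ind (z ^+ 2 == y ^+ 2) * ind (w ^+ 2 == x ^+ 2)
  - ind (y ^+ 2 == x ^+ 2) * (ind (z ^+ 2 == x ^+ 2) * ind (w ^+ 2 == x ^+ 2)))).
  apply: eq_bigr => z _; apply: eq_bigr => w _.
  have -> : (powers x + powers y == powers z + powers w) =
      (z ^+ 2 == x ^+ 2) && (w ^+ 2 == y ^+ 2) || (z ^+ 2 == y ^+ 2) && (w ^+ 2 == x ^+ 2).
    apply/eqP/orP.
      move=> [p1 p2 _]; have := @power_sums2 _ three0 (x ^+ 2) (y ^+ 2) (z ^+ 2) (w ^+ 2).
      by rewrite -!exprM => /(_ p1 p2)[] [-> ->]; [left|right]; rewrite !eqxx.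
    case=> /andP[/eqP e1 /eqP e2]; rewrite /powers !(exprM _ 2 2) !(exprM _ 2 5) e1 e2 //.
    by congr (_, _, _); rewrite addrC.
  have [->|zx] := eqVneq (z ^+ 2) (x ^+ 2).
    rewrite (eq_sym (y ^+ 2)); have [->|wy] := eqVneq (w ^+ 2) (y ^+ 2).
      by rewrite (eq_sym (y ^+ 2)); case: (_ == _); rewrite /= ?mul1r ?mul0r ?subr0 ?addr0 ?addrK.
    rewrite /= mul1r add0r; have [xy|_] := eqVneq (x ^+ 2) (y ^+ 2); last by rewrite !mul0r subrr.
    by rewrite xy (negPf wy) !mulr0 subrr.
  by rewrite /= !mul0r mulr0 subr0 add0r -natrM mulnb.
under eq_bigr do rewrite sumrB big_split /= -!mulr_sumr !sum_ind_sqr1.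
rewrite sumrB big_split /= -mulr_sumr -!mulr_suml !sum_ind_sqr1 /pair_roots; ring.
Qed.

Lemma sum_pair_roots_all : \sum_x \sum_y pair_roots x y = 8 * q ^+ 2 - 16 * q + 9.
Proof.
(* For fixed x the correction adds up to [nroots x ^+ 3], which is 8, or 1 at x = 0. *)
transitivity (\sum_x (2 * (2 * q - 1) * nroots x - (8 - 7 * ind (x == 0)))).
  apply: eq_bigr => x _; rewrite sumrB -!mulr_sumr sum_nroots -mulr_suml sum_ind_sqr1.
  by congr (_ - _); [ring | rewrite /nroots; case: (x == 0)].
rewrite !sumrB -!mulr_sumr sum_nroots sum_cst sum_ind1; ring.
Qed.

Lemma pair_roots0 x : pair_roots x 0 = 4 - 3 * ind (x == 0).
Proof.
rewrite /pair_roots /nroots eqxx expr0n /= (eq_sym 0) sqrf_eq0.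
by case: (x == 0).
Qed.

Lemma pair_roots0l x : pair_roots 0 x = 4 - 3 * ind (x == 0).
Proof.
rewrite /pair_roots /nroots eqxx expr0n /= sqrf_eq0.
by case: (x == 0).
Qed.

Lemma count22 : \sum_(x : F) \sum_(y : F) \sum_(z : F) \sum_(w : F)
  ind (powers x + powers y - powers z - powers w == 0) = 8 * q ^+ 2 - 16 * q + 9.
Proof.
rewrite -sum_pair_roots_all; apply: eq_bigr => x _; apply: eq_bigr => y _.
rewrite -sum_pair_roots; apply: eq_bigr => z _; apply: eq_bigr => w _.
by rewrite -addrA -opprD subr_eq0.
Qed.

Lemma sum3_prod (A B C : F -> int) :
  \sum_x \sum_y \sum_z A x * (B y * C z) = (\sum_x A x) * ((\sum_y B y) * (\sum_z C z)).
Proof.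
rewrite mulr_suml; apply: eq_bigr => x _.
rewrite mulr_suml mulr_sumr; apply: eq_bigr => y _.
by rewrite !mulr_sumr.
Qed.

(** By [power_sums31], each nonzero w has 6 solutions: one variable is w or -w and the others
    vanish. For w = 0 the condition is x^2 = y^2 = z^2, with 4 q - 3 solutions. *)
Lemma count31 : \sum_(w : F) \sum_(x : F) \sum_(y : F) \sum_(z : F)
  ind (- powers w + powers x + powers y + powers z == 0) = 10 * q - 9.
Proof.
have E (x y z w : F) : - powers w + powers x + powers y + powers z == 0 ->
  [/\ x ^+ 2 + y ^+ 2 + z ^+ 2 = w ^+ 2, (x ^+ 2) ^+ 2 + (y ^+ 2) ^+ 2 + (z ^+ 2) ^+ 2 = (w ^+ 2) ^+ 2
    & (x ^+ 2) ^+ 5 + (y ^+ 2) ^+ 5 + (z ^+ 2) ^+ 5 = (w ^+ 2) ^+ 5].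
  by rewrite -!addrA addrC subr_eq0 -!exprM !addrA => /eqP[p1 p2 p5]; split.
have sq0 (a : F) : (a ^+ 2 == 0) = (a == 0) by rewrite expf_eq0.
transitivity (\sum_(w : F) (6 + ind (w == 0) * (4 * q - 9))); last first.
  by rewrite big_split /= sum_cst (sum_ind 0 (fun=> _)); ring.
apply: eq_bigr => w _; have [->|w0] := eqVneq w 0.
  transitivity (\sum_(x : F) \sum_(y : F) \sum_(z : F) ind (y ^+ 2 == x ^+ 2) * ind (z ^+ 2 == x ^+ 2)).
    apply: eq_bigr => x _; apply: eq_bigr => y _; apply: eq_bigr => z _.
    rewrite -natrM mulnb; congr (nat_of_bool _)%:R; apply/idP/andP.
      move=> /E[p1 p2 p5]; have := power_sums31 three0 p1 p2 p5.
      by rewrite expr0n eqxx => -[-> ->]; rewrite !eqxx.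
    case=> /eqP e1 /eqP e2; rewrite powers0 oppr0 add0r /powers !(exprM _ 2 2) !(exprM _ 2 5) e1 e2.
    have thrice (a : F) : a + a + a = 0 by transitivity (3 * a); [ring | rewrite three0 mul0r].
    by apply/eqP; congr (_, _, _); apply: thrice.
  transitivity (\sum_(x : F) (4 - 3 * ind (x == 0))); last first.
    by rewrite sumrB sum_cst -mulr_sumr sum_ind1 /=; ring.
  apply: eq_bigr => x _; under eq_bigr do rewrite -mulr_sumr sum_ind_sqr1.
  by rewrite -mulr_suml sum_ind_sqr1 /nroots; case: (x == 0).
transitivity (\sum_(x : F) \sum_(y : F) \sum_(z : F) (
   ind (x == 0) * (ind (y == 0) * ind (z ^+ 2 == w ^+ 2)) +
   ind (x == 0) * (ind (y ^+ 2 == w ^+ 2) * ind (z == 0)) +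
   ind (x ^+ 2 == w ^+ 2) * (ind (y == 0) * ind (z == 0)))); last first.
  under eq_bigr do under eq_bigr do rewrite !big_split.
  under eq_bigr do rewrite !big_split.
  by rewrite !big_split /= !sum3_prod !sum_ind_sqr1 !sum_ind1 /nroots (negPf w0) /=; ring.
apply: eq_bigr => x _; apply: eq_bigr => y _; apply: eq_bigr => z _.
have w20 : 0 == w ^+ 2 = false by rewrite eq_sym sq0 (negPf w0).
transitivity (ind ([&& x == 0, y == 0 & z ^+ 2 == w ^+ 2] ||
   [&& x == 0, y ^+ 2 == w ^+ 2 & z == 0] || [&& x ^+ 2 == w ^+ 2, y == 0 & z == 0])).
  congr (nat_of_bool _)%:R; apply/idP/orP.
    move=> /E[p1 p2 p5]; have := power_sums31 three0 p1 p2 p5.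
    rewrite sq0 (negPf w0) => -[[/eqP + /eqP + ->]|[/eqP + /eqP + ->]|[/eqP + /eqP + ->]];
      rewrite !sq0 => -> -> /=; rewrite eqxx ?orbT; by [left|right].
  by case=> [/orP[]|] /and3P[/eqP e1 /eqP e2 /eqP e3];
    rewrite /powers !(exprM _ 2 2) !(exprM _ 2 5) ?e1 ?e2 ?e3 !expr0n /= -!addrA addrC subr_eq0;
    apply/eqP; congr (_, _, _); rewrite /= ?addr0 ?add0r.
have [->|x0] := eqVneq x 0; have [->|y0] := eqVneq y 0; have [->|z0] := eqVneq z 0;
  rewrite ?expr0n /= ?w20 ?mul0r ?mulr0 ?mul1r ?mulr1 ?orbF ?andbF ?andbT ?addr0 ?add0r //.
Qed.

(** Zero variables are removed in the order z, y, x, which keeps the cases disjoint and reduces them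
    to [pair_roots]; the last term is [power_sums32], where none vanishes. *)
Definition triple_roots (x y z : F) : int :=
  ind (z == 0) * pair_roots x y
  + ind (y == 0) * ((1 - ind (z == 0)) * pair_roots x z)
  + ind (x == 0) * ((1 - ind (z == 0)) * (1 - ind (y == 0)) * pair_roots y z)
  + ind (x * y != 0) * (ind (z != 0) * (ind (z ^+ 2 == (x + y) ^+ 2) * nroots (x - y) ^+ 2
    + ind (z ^+ 2 == (x - y) ^+ 2) * nroots (x + y) ^+ 2)).

Lemma sum_triple_roots x y z :
  \sum_u \sum_v ind (powers x + powers y + powers z - powers u - powers v == 0) =
  triple_roots x y z.
Proof.
under eq_bigr do under eq_bigr do rewrite -addrA -opprD subr_eq0.
rewrite /triple_roots.
have [->|z0] := eqVneq z 0.
  by rewrite powers0 addr0 sum_pair_roots /=; ring.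
have [->|y0] := eqVneq y 0.
  by rewrite powers0 addr0 sum_pair_roots /= (mulr0 x) eqxx /=; ring.
have [->|x0] := eqVneq x 0.
  by rewrite powers0 add0r sum_pair_roots /= (mul0r y) eqxx /=; ring.
rewrite /= mulf_neq0 //= !mul0r !add0r !mul1r.
have xyz0 : x * y * z != 0 by rewrite !mulf_neq0.
(* The difference is 4 x y = x y, so the two alternatives exclude each other and their indicators
   add up. *)
have dis : ((x + y) ^+ 2 == (x - y) ^+ 2) = false.
  apply/eqP => /eqP; rewrite -subr_eq0.
  have -> : (x + y) ^+ 2 - (x - y) ^+ 2 = x * y + 3 * (x * y) by ring.
  by rewrite three0 mul0r addr0 (negPf (mulf_neq0 x0 y0)).
transitivity (\sum_(u : F) \sum_(v : F) (ind (z ^+ 2 == (x + y) ^+ 2) *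
     (ind (u ^+ 2 == (x - y) ^+ 2) * ind (v ^+ 2 == (x - y) ^+ 2))
   + ind (z ^+ 2 == (x - y) ^+ 2) *
     (ind (u ^+ 2 == (x + y) ^+ 2) * ind (v ^+ 2 == (x + y) ^+ 2)))).
  apply: eq_bigr => u _; apply: eq_bigr => v _.
  rewrite -!natrM !mulnb -natrD; congr _%:R.
  set A := _ && _; set B := _ && _.
  have AB : A && B = false.
    by apply/negP; rewrite /A /B => /andP[/andP[/eqP -> _] /andP[]]; rewrite dis.
  transitivity (nat_of_bool (A || B)); last by move: AB; case: A; case: B.
  congr nat_of_bool; have h := @power_sums32 _ three0 x y z u v xyz0.
  apply/eqP/idP.
    case=> p1 p2 p5; case: h => + _; rewrite /A /B => /(_ (And3 p1 p2 p5)).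
    by case=> -[-> [-> ->]]; rewrite !eqxx ?orbT.
  move=> /orP hAB; case: h => _ [].
    by case: hAB => /andP[/eqP ? /andP[/eqP ? /eqP ?]]; [left|right].
  by move=> p1 p2 p5; congr (_, _, _).
under eq_bigr do rewrite big_split /= -!mulr_sumr !sum_ind_sqr1.
by rewrite big_split /= -!mulr_sumr -!mulr_suml !sum_ind_sqr1 !expr2.
Qed.

End Counting.

(** * Solutions with three terms against two *)

Section Counting32.
Set Implicit Arguments.
Unset Strict Implicit.

Variable F : finFieldType.
Hypothesis three0 : 3 = 0 :> F.

Local Notation ind b := ((nat_of_bool b)%:R : int).
Local Notation q := (#|F|%:R : int).

Lemma sum_ind_sqr_neq0 (a : F) : \sum_z ind (z ^+ 2 == a ^+ 2) * ind (z != 0) = 2 * ind (a != 0).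
Proof. by rewrite (sum_ind_sqr three0) oppr_eq0; case: (a == 0). Qed.

Lemma sum_pair_roots_neq0 (x : F) :
  \sum_z (1 - ind (z == 0)) * pair_roots x z = \sum_z pair_roots x z - (4 - 3 * ind (x == 0)).
Proof.
under eq_bigr do rewrite mulrBl mul1r.
by rewrite sumrB sum_ind pair_roots0.
Qed.

(** For xy nonzero, the generic contribution is 2 * 4 + 2 * 4 = 16. If y = x or y = -x, one
    alternative would need z = 0 and the other has u = v = 0, leaving 2 = 16 - 14. *)
Lemma sum_triple_roots_line (x y : F) :
  \sum_z ind (x * y != 0) * (ind (z != 0) * (ind (z ^+ 2 == (x + y) ^+ 2) * nroots (x - y) ^+ 2
    + ind (z ^+ 2 == (x - y) ^+ 2) * nroots (x + y) ^+ 2)) =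
  ind (x != 0) * (16 - 16 * ind (y == 0) - 14 * ind (y == x) - 14 * ind (y == - x)).
Proof.
have [->|x0] := eqVneq x 0.
  by rewrite mul0r eqxx /= mul0r big1 // => z _; rewrite !mul0r.
have [->|y0] := eqVneq y 0.
  rewrite mulr0 eqxx /= big1 => [|z _]; last by rewrite !mul0r.
  by rewrite eq_sym (negPf x0) eq_sym oppr_eq0 (negPf x0) /=; ring.
rewrite mulf_neq0 //= !mul1r mulr0 subr0.
transitivity (\sum_z (ind (z ^+ 2 == (x + y) ^+ 2) * ind (z != 0) * nroots (x - y) ^+ 2
   + ind (z ^+ 2 == (x - y) ^+ 2) * ind (z != 0) * nroots (x + y) ^+ 2)).
  by apply: eq_bigr => z _; ring.
rewrite big_split /= -!mulr_suml !sum_ind_sqr_neq0 /nroots subr_eq0 (eq_sym x y).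
rewrite (addrC x y) addr_eq0.
have [->|] := eqVneq y x; first by rewrite (eq_oppr three0) (negPf x0).
by move=> _; case: (y == - x).
Qed.

(** The four cases of [triple_roots] contribute 8 q^2 - 16 q + 9, 8 q^2 - 20 q + 12, 8 q^2 - 24 q +
    16 and (q - 1)(16 q - 44). *)
Lemma count32 : \sum_(x : F) \sum_(y : F) \sum_(z : F) \sum_(u : F) \sum_(v : F)
  ind (powers x + powers y + powers z - powers u - powers v == 0) =
  1 + 40 * (q - 1) * (q - 2).
Proof.
under eq_bigr do under eq_bigr do under eq_bigr do rewrite (sum_triple_roots three0) /triple_roots.
under eq_bigr do under eq_bigr do rewrite !big_split sum_triple_roots_line /=.
under eq_bigr do rewrite !big_split /=.
rewrite !big_split /=.
have sum0 (f : F -> int) : \sum_z ind (z == 0) * f z = f 0 by apply: sum_ind.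
have T1 : \sum_(x : F) \sum_(y : F) \sum_(z : F) ind (z == 0) * pair_roots x y = 8 * q ^+ 2 - 16 * q + 9.
  under eq_bigr do under eq_bigr do rewrite (sum0 (fun=> _)).
  exact: sum_pair_roots_all.
have T2 : \sum_(x : F) \sum_(y : F) \sum_(z : F) ind (y == 0) * ((1 - ind (z == 0)) * pair_roots x z)
    = 8 * q ^+ 2 - 20 * q + 12.
  under eq_bigr do (under eq_bigr do rewrite -mulr_sumr sum_pair_roots_neq0; rewrite (sum0 (fun=> _))).
  rewrite !sumrB (sum_pair_roots_all three0) sum_cst -mulr_sumr sum_ind1; ring.
have T3 : \sum_(x : F) \sum_(y : F) \sum_(z : F)
    ind (x == 0) * ((1 - ind (z == 0)) * (1 - ind (y == 0)) * pair_roots y z)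
    = 8 * q ^+ 2 - 24 * q + 16.
  under eq_bigr do under eq_bigr do rewrite -mulr_sumr.
  under eq_bigr do rewrite -mulr_sumr.
  rewrite (sum0 (fun=> _)).
  transitivity (\sum_(y : F) (1 - ind (y == 0)) * (\sum_z pair_roots y z - (4 - 3 * ind (y == 0)))).
    apply: eq_bigr => y _; rewrite -sum_pair_roots_neq0 mulr_sumr.
    by apply: eq_bigr => z _; rewrite (mulrC (1 - _)) mulrA.
  under eq_bigr do rewrite mulrBl mul1r.
  have S0 : \sum_(x : F) (4 - 3 * ind (x == 0)) = 4 * q - 3.
    by rewrite sumrB sum_cst -mulr_sumr sum_ind1; ring.
  rewrite sumrB sum0 sumrB (sum_pair_roots_all three0) S0 eqxx /=.
  by under eq_bigr do rewrite pair_roots0l; rewrite S0; ring.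
rewrite T1 T2 T3.
under eq_bigr do rewrite -mulr_sumr !sumrB sum_cst -!mulr_sumr !sum_ind1 indN.
rewrite -mulr_suml sumrB sum_cst sum_ind1; ring.
Qed.

End Counting32.

(** * Moments and the linear system *)

Section Moments.
Set Implicit Arguments.
Unset Strict Implicit.

Variables (R : realType) (m : nat) (F : finFieldType).
Hypothesis cardF : #|F| = (3 ^ m)%N.

Let pr3 : prime 3 := isT.
Let three0 := three_eq0 cardF.
Local Notation V := (F * F * F)%type.
Local Notation C := (R[i]).
Local Notation S := (@charsum R 3 m F F powers).
Local Notation q := (#|F|%:R : int).
Local Notation ind b := ((nat_of_bool b)%:R : int).

Lemma sum_prod (I J : finType) (G : I * J -> int) :
  \sum_p G p = \sum_i \sum_j G (i, j).
Proof. by rewrite pair_bigA; apply: eq_bigr => -[]. Qed.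

Lemma sum_charsum_int (I : finType) (f : I -> V) :
  \sum_t charsum R 3 m f t = (q ^+ 3 * \sum_i ind (f i == 0))%:~R.
Proof.
rewrite (sum_charsum R pr3 cardF) -[LHS]/(_%:Z%:~R) PoszM; congr (_ * _)%:~R.
  by rewrite natz PoszM; congr (_ * _); rewrite ?PoszM.
by rewrite -natz natr_sum.
Qed.

Lemma charsum_powers0 : S 0 = #|F|%:R.
Proof.
rewrite /charsum (eq_bigr (fun=> 1)) ?sumr_const // => x _.
by rewrite /= !mul0r !addr0 (psi0 R pr3 cardF).
Qed.

Lemma sum_neq0 (f : V -> C) (N : int) : \sum_(t : V) f t = N%:~R ->
  \sum_(t : V | t != 0) f t = N%:~R - f 0.
Proof. by move=> <-; rewrite [X in _ = X - _](bigD1 (0 : V)) //= addrC addrK. Qed.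

Lemma moment00 : \sum_(t : V) (1 : C) = (q ^+ 3)%:~R.
Proof. by rewrite sumr_const !card_prod rmorphXn /= rmorph_nat !natrM; ring. Qed.

Lemma moment10 : \sum_(t : V) S t = (q ^+ 3)%:~R.
Proof. by rewrite sum_charsum_int (count10 F) mulr1. Qed.

Lemma moment20 : \sum_(t : V) S t * S t = (q ^+ 3)%:~R.
Proof.
under eq_bigr do rewrite (charsumM R pr3 cardF).
by rewrite sum_charsum_int !sum_prod /= (count20 three0) mulr1.
Qed.

Lemma moment11 : \sum_(t : V) S t * (S t)^*%C = (q ^+ 3 * (2 * q - 1))%:~R.
Proof.
under eq_bigr do rewrite (charsum_conj R pr3 cardF) (charsumM R pr3 cardF).
by rewrite sum_charsum_int !sum_prod /= (count11 three0).
Qed.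

Lemma moment21 : \sum_(t : V) S t * S t * (S t)^*%C = (q ^+ 3 * (4 * q - 3))%:~R.
Proof.
under eq_bigr do rewrite (charsum_conj R pr3 cardF) !(charsumM R pr3 cardF).
by rewrite sum_charsum_int !sum_prod /= (count21 three0).
Qed.

Lemma moment22 : \sum_(t : V) S t * S t * (S t)^*%C * (S t)^*%C =
  (q ^+ 3 * (8 * q ^+ 2 - 16 * q + 9))%:~R.
Proof.
under eq_bigr do rewrite (charsum_conj R pr3 cardF) !(charsumM R pr3 cardF).
by rewrite sum_charsum_int !sum_prod /= (count22 three0).
Qed.

Lemma moment31 : \sum_(t : V) (S t)^*%C * S t * S t * S t = (q ^+ 3 * (10 * q - 9))%:~R.
Proof.
under eq_bigr do rewrite (charsum_conj R pr3 cardF) !(charsumM R pr3 cardF).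
by rewrite sum_charsum_int !sum_prod /= (count31 three0).
Qed.

Lemma moment32 : \sum_(t : V) S t * S t * S t * (S t)^*%C * (S t)^*%C =
  (q ^+ 3 * (1 + 40 * (q - 1) * (q - 2)))%:~R.
Proof.
under eq_bigr do rewrite (charsum_conj R pr3 cardF) !(charsumM R pr3 cardF).
by rewrite sum_charsum_int !sum_prod /= (count32 three0).
Qed.

End Moments.

(** * Linear equations for the eight counts *)

Section CountEquations.
Set Implicit Arguments.
Unset Strict Implicit.

Variables (R : realType) (k : nat) (F : finFieldType).
Local Notation m := (2 * k)%N.
Hypothesis cardF : #|F| = (3 ^ m)%N.

Let m_even : ~~ odd m. Proof. by rewrite oddM. Qed.
Local Notation val := (expsum_value R 3 m).
Local Notation V := (F * F * F)%type.
Local Notation C := (R[i]).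
Local Notation S := (@charsum R 3 m F F powers).
Local Notation s := (3 ^+ k).
Local Notation n_ eps j := (nval R 3 m F eps j).

Lemma powR_half j : (3 : R) `^ ((m + j)%:R / 2) = 3 ^+ k * (3 `^ (j%:R / 2)).
Proof.
rewrite natrD mulrDl powRD; last by rewrite pnatr_eq0 implybT.
by rewrite natrM mulrAC mulfV ?pnatr_eq0 // mul1r powR_mulrn.
Qed.

Lemma expsum_value_add2 eps j : val eps j.+2 = 3 * val eps j.
Proof.
rewrite /expsum_value /= negbK !powR_half -(addn2 j) natrD mulrDl powRD; last by rewrite pnatr_eq0 implybT.
by rewrite divff ?pnatr_eq0 // powRr1 // !rmorphM /= (rmorph_nat _ 3); ring.
Qed.

Lemma expsum_value0 : val 1 0 = (3 ^+ k : int)%:~R.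
Proof.
rewrite /expsum_value /= powR_half mul0r powRr0 mulr1 mulr1 mul1r.
by rewrite !rmorphXn /= (rmorph_nat _ 3).
Qed.

(** The moments see [tau] only through its square and its conjugate, so its explicit value i sqrt 3
    stays hidden. *)
Lemma expsum_value1 : exists tau : C,
  [/\ tau ^+ 2 = - 3, tau^*%C = - tau & val 1 1 = (3 ^+ k : int)%:~R * tau].
Proof.
have v0 : val 1 0 != 0 by apply: expsum_value_neq0.
have vE : val 1 1 = val 1 0 * (val 1 1 / val 1 0) by rewrite mulrC divfK.
rewrite -expsum_value0; exists (val 1 1 / val 1 0); split=> //.
  rewrite expr_div_n !sqr_expsum_value // !expr1n !mul1r addn1 addn0 exprS mulfK //.
  by rewrite expf_neq0 // oppr_eq0 pnatr_eq0.
apply: (mulfI v0); rewrite mulrN -vE.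
have {1}-> : val 1 0 = (val 1 0)^*%C by rewrite conj_expsum_value mul1r.
by rewrite -conjcM -vE conj_expsum_value mulN1r.
Qed.

(** These are the moments 00, 10, 20, 11, 21, 22, 31, 32 in this order. The power of q subtracted
    last on each right-hand side is the term at t = 0, where S = q. *)
Lemma count_equations :
  let x j : int := (n_ 1 j)%:R in let y j : int := (n_ (-1) j)%:R in
  let n1 : int := (n_ 1 1)%:R in let n3 : int := (n_ 1 3)%:R in
  let s : int := 3 ^+ k in let q := s ^+ 2 in
  [/\ x 0%N + y 0%N + 2 * n1 + x 2%N + y 2%N + 2 * n3 + x 4%N + y 4%N = q ^+ 3 - 1,
  s * (x 0%N - y 0%N + 3 * (x 2%N - y 2%N) + 9 * (x 4%N - y 4%N)) = q ^+ 3 - q,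
  q * (x 0%N + y 0%N - 6 * n1 + 9 * (x 2%N + y 2%N) - 54 * n3 + 81 * (x 4%N + y 4%N)) = q ^+ 3 - q ^+ 2 &
  [/\ q * (x 0%N + y 0%N + 6 * n1 + 9 * (x 2%N + y 2%N) + 54 * n3 + 81 * (x 4%N + y 4%N))
     = q ^+ 3 * (2 * q - 1) - q ^+ 2,
  s ^+ 3 * (x 0%N - y 0%N + 27 * (x 2%N - y 2%N) + 3 ^+ 6 * (x 4%N - y 4%N)) = q ^+ 3 * (4 * q - 3) - q ^+ 3,
  q ^+ 2 * (x 0%N + y 0%N + 18 * n1 + 81 * (x 2%N + y 2%N) + 2 * 3 ^+ 6 * n3 + 3 ^+ 8 * (x 4%N + y 4%N))
     = q ^+ 3 * (8 * q ^+ 2 - 16 * q + 9) - q ^+ 4,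
  q ^+ 2 * (x 0%N + y 0%N - 18 * n1 + 81 * (x 2%N + y 2%N) - 2 * 3 ^+ 6 * n3 + 3 ^+ 8 * (x 4%N + y 4%N))
     = q ^+ 3 * (10 * q - 9) - q ^+ 4 &
  s ^+ 5 * (x 0%N - y 0%N + 243 * (x 2%N - y 2%N) + 3 ^+ 10 * (x 4%N - y 4%N))
     = q ^+ 3 * (1 + 40 * (q - 1) * (q - 2)) - q ^+ 5]].
Proof.
move=> x y n1 n3 s' q'.
have pr3 : prime 3 by [].
have o1 : n_ (-1) 1 = n_ 1 1 by apply: nval_odd_opp.
have o3 : n_ (-1) 3 = n_ 1 3 by apply: nval_odd_opp.
have qE : #|F|%:R = q' by rewrite cardF natrX /q' /s' mulnC exprM.
have [tau [tau2 tauc]] := expsum_value1; have := expsum_value0; rewrite -/s'.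
have v2 := expsum_value_add2 1 0; have v3 := expsum_value_add2 1 1; have v4 := expsum_value_add2 1 2.
have conjN (z : C) : (- z)^*%C = - z^*%C by exact: rmorphN.
have conj3 : (3 : C)^*%C = 3 by exact: rmorph_nat.
have S0 : @charsum R 3 m F F powers 0 = q'%:~R by rewrite (charsum_powers0 R cardF) -qE rmorph_nat.
rewrite /q' in S0 qE *; move: s' {q'} qE S0 => s qE S0 v0 v1.
have xE j : (x j)%:~R = (n_ 1 j)%:R :> C by apply: rmorph_nat.
have yE j : (y j)%:~R = (n_ (-1) j)%:R :> C by apply: rmorph_nat.
have n1E : n1%:~R = (n_ 1 1)%:R :> C by apply: rmorph_nat.
have n3E : n3%:~R = (n_ 1 3)%:R :> C by apply: rmorph_nat.
clearbody x y n1 n3.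
(* The shape common to all moments, with the ten values written in [s] and [tau]: raising j by 2
   multiplies a value by 3. *)
have EQ (f : C -> C) (N : int) : \sum_(t : V) f (S t) = N%:~R ->
    (N - 0)%:~R - f (s ^+ 2)%:~R = (x 0%N)%:~R * f s%:~R + (y 0%N)%:~R * f (- s%:~R)
      + (n1%:~R * f (s%:~R * tau) + n1%:~R * f (- (s%:~R * tau)))
      + ((x 2%N)%:~R * f (3 * s%:~R) + (y 2%N)%:~R * f (- (3 * s%:~R)))
      + (n3%:~R * f (3 * (s%:~R * tau)) + n3%:~R * f (- (3 * (s%:~R * tau))))
      + ((x 4%N)%:~R * f (3 * (3 * s%:~R)) + (y 4%N)%:~R * f (- (3 * (3 * s%:~R)))).
  move=> h; have := sum_neq0 h; rewrite S0 subr0 => <-.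
  rewrite (sum_by_value cardF m_even) !big_ord_recl big_ord0 addr0 /= /bump /=.
  rewrite !expsum_valueN v4 v3 v2 v1 v0 o1 o3 !addrA.
  by rewrite n1E n3E (xE 0%N) (xE 2) (xE 4) (yE 0%N) (yE 2) (yE 4).
have eqs := (EQ (fun=> 1) _ (moment00 R F), EQ (fun z => z) _ (moment10 R cardF),
  EQ (fun z => z * z) _ (moment20 R cardF), EQ (fun z => z * z^*%C) _ (moment11 R cardF),
  EQ (fun z => z * z * z^*%C) _ (moment21 R cardF),
  EQ (fun z => z * z * z^*%C * z^*%C) _ (moment22 R cardF),
  EQ (fun z => z^*%C * z * z * z) _ (moment31 R cardF),
  EQ (fun z => z * z * z * z^*%C * z^*%C) _ (moment32 R cardF)).
move: eqs; rewrite /= !(conjcM, conjN, conj3, tauc, conjc_int) qE.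
move=> [[[[[[[E0 E1] E2] E11] E21] E22] E31] E32].
split; try apply: (@intr_inj C).
- by apply: (etrans _ (etrans (esym E0) _)); ring.
- by apply: (etrans _ (etrans (esym E1) _)); ring.
- by apply: (etrans _ (etrans (esym E2) _)); ring: tau2.
split; apply: (@intr_inj C).
- by apply: (etrans _ (etrans (esym E11) _)); ring: tau2.
- by apply: (etrans _ (etrans (esym E21) _)); ring: tau2.
- by apply: (etrans _ (etrans (esym E22) _)); ring: tau2.
- by apply: (etrans _ (etrans (esym E31) _)); ring: tau2.
- by apply: (etrans _ (etrans (esym E32) _)); ring: tau2.
Qed.

End CountEquations.

(** * Closed forms of the constants for p = 3 and even m *)

Section Constants.
Set Implicit Arguments.
Unset Strict Implicit.

Variable k : nat.
Local Notation m := (2 * k)%N.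
Local Notation s := (3 ^+ k : rat).

Lemma c1E : c1 3 m = s ^+ 6 - 1.
Proof. by rewrite /c1 mulnA mulnC exprM. Qed.

Lemma half_m : (m./2 = k)%N. Proof. lia. Qed.

Lemma c2E : c2 3 m = s * (s ^+ 4 - 1).
Proof. by rewrite /c2 half_m mulnA mulnC exprM. Qed.

Lemma c3E : c3 3 m = s ^+ 2 * (s ^+ 2 - 1).
Proof. by rewrite /c3 mulnC exprM. Qed.

Lemma c4E : c4 3 m = 4 * s ^+ 3 * (s ^+ 2 - 1).
Proof.
have -> : c4 3 m = (3 + 1) * 3 ^+ (k * 3) * (3 ^+ (k * 2) - 1).
  by rewrite /c4 (mulnC 2); congr (_ * 3 ^+ _ * _); lia.
by rewrite !exprM; ring.
Qed.

Lemma c5E : c5 3 m = (8 * (s ^+ 2 - 1) ^+ 2 - s ^+ 2 + 1) * s ^+ 2.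
Proof. by rewrite /c5 (mulnC 2) !exprM. Qed.

Lemma c6E : c6 3 m = (5 * (s ^+ 2 - 1) * (8 * s ^+ 2 - 16) - s ^+ 4 + 1) * s.
Proof.
rewrite /c6 half_m mulnA (mulnC (2 * 2)%N) (mulnC 2%N) !exprM; ring.
Qed.

Lemma expr3_sub (n e : nat) : (e <= n * k)%N -> 3 ^+ (n * k - e) = s ^+ n / 3 ^+ e :> rat.
Proof.
move=> le; rewrite -exprM (mulnC k) -[X in _ = _ ^+ X / _](subnK le) exprD.
by rewrite mulfK // expf_neq0.
Qed.

Hypothesis k_ge3 : (3 <= k)%N.

(** The bound on k makes the truncated subtractions in the exponents exact. With q = s^2, the result
    is the part of the moment of |S|^2 coming from the values with even j, divided by q. *)
Lemma aE : a_const 3 m = s ^+ 6 - s ^+ 2.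
Proof.
have s0 : s != 0 by rewrite expf_neq0.
rewrite /a_const /A2' mulnBr !mulnA muln1 !expr3_sub //; try nia.
rewrite !(mulnC _ k) !exprM; field.
by rewrite s0.
Qed.

(** Likewise the even part of the moment of |S|^4, divided by q^2. *)
Lemma bE : b_const 3 m = 4 * s ^+ 4 * (s ^+ 2 - 1).
Proof.
have s0 : s != 0 by rewrite expf_neq0.
rewrite /b_const aE /A2' /A4' exprD !mulnBr !mulnA !muln1 !expr3_sub //; try nia.
rewrite !(mulnC _ k) !exprM; field.
by rewrite s0.
Qed.

End Constants.

(** * Solution of the linear system *)

Section System.
Set Implicit Arguments.
Unset Strict Implicit.

Variables (s a b c1 c2 c3 c4 c5 c6 : rat).
Variables (x0 y0 n1 x2 y2 n3 x4 y4 : rat).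
Local Notation q := (s ^+ 2).
Local Notation P := (3%:R : rat).

Hypotheses (s0 : s != 0)
  (c1E : c1 = s ^+ 6 - 1) (c2E : c2 = s * (s ^+ 4 - 1)) (c3E : c3 = s ^+ 2 * (s ^+ 2 - 1))
  (c4E : c4 = 4 * s ^+ 3 * (s ^+ 2 - 1))
  (c5E : c5 = (8 * (s ^+ 2 - 1) ^+ 2 - s ^+ 2 + 1) * s ^+ 2)
  (c6E : c6 = (5 * (s ^+ 2 - 1) * (8 * s ^+ 2 - 16) - s ^+ 4 + 1) * s)
  (aE : a = s ^+ 6 - s ^+ 2) (bE : b = 4 * s ^+ 4 * (s ^+ 2 - 1)).

Hypotheses
  (H0 : x0 + y0 + 2 * n1 + x2 + y2 + 2 * n3 + x4 + y4 = q ^+ 3 - 1)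
  (H1 : s * (x0 - y0 + 3 * (x2 - y2) + 9 * (x4 - y4)) = q ^+ 3 - q)
  (H2 : q * (x0 + y0 - 6 * n1 + 9 * (x2 + y2) - 54 * n3 + 81 * (x4 + y4)) = q ^+ 3 - q ^+ 2)
  (H11 : q * (x0 + y0 + 6 * n1 + 9 * (x2 + y2) + 54 * n3 + 81 * (x4 + y4))
     = q ^+ 3 * (2 * q - 1) - q ^+ 2)
  (H21 : s ^+ 3 * (x0 - y0 + 27 * (x2 - y2) + 3 ^+ 6 * (x4 - y4)) = q ^+ 3 * (4 * q - 3) - q ^+ 3)
  (H22 : q ^+ 2 * (x0 + y0 + 18 * n1 + 81 * (x2 + y2) + 2 * 3 ^+ 6 * n3 + 3 ^+ 8 * (x4 + y4))
     = q ^+ 3 * (8 * q ^+ 2 - 16 * q + 9) - q ^+ 4)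
  (H31 : q ^+ 2 * (x0 + y0 - 18 * n1 + 81 * (x2 + y2) - 2 * 3 ^+ 6 * n3 + 3 ^+ 8 * (x4 + y4))
     = q ^+ 3 * (10 * q - 9) - q ^+ 4)
  (H32 : s ^+ 5 * (x0 - y0 + 243 * (x2 - y2) + 3 ^+ 10 * (x4 - y4))
     = q ^+ 3 * (1 + 40 * (q - 1) * (q - 2)) - q ^+ 5).

(** Divided by the proper power of s, six moments become the equations with right-hand sides [c1] to
    [c6]; [a] and [b] come from combining two moments of the same order. *)
Lemma solve_moments :
  [/\ x0 =
        - ((b + c6 - a * P ^+ 2 - a * P ^+ 3 - a * P ^+ 4 - a * P ^+ 5
            - b * P ^+ 2 + c1 * P ^+ 6 + c2 * P ^+ 6 + c3 * P ^+ 3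
            + c3 * P ^+ 5 - c4 * P ^+ 2 - c4 * P ^+ 4 + c5 * P ^+ 2)
           / (- 2 * P ^+ 6 + 2 * P ^+ 4 + 2 * P ^+ 2 - 2)),
      y0 =
        - ((b - c6 - a * P ^+ 2 - a * P ^+ 3 - a * P ^+ 4 - a * P ^+ 5
            - b * P ^+ 2 + c1 * P ^+ 6 - c2 * P ^+ 6 + c3 * P ^+ 3
            + c3 * P ^+ 5 + c4 * P ^+ 2 + c4 * P ^+ 4 + c5 * P ^+ 2)
           / (- 2 * P ^+ 6 + 2 * P ^+ 4 + 2 * P ^+ 2 - 2)),
      2 * n1 =
        - (b - c5 + a * P ^+ 3 - c3 * P ^+ 3) / (P ^+ 2 - P ^+ 4),
      x2 =
        (c4 - c6 + a * P - c5 * P + a * P ^+ 2 + a * P ^+ 4 + a * P ^+ 5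
         - c1 * P ^+ 5 - c2 * P ^+ 4 - c3 * P ^+ 2 - c3 * P ^+ 4
         + c4 * P ^+ 4)
        / (2 * P ^+ 7 - 4 * P ^+ 5 + 2 * P ^+ 3)
    & [/\ y2 =
            - ((c4 - c6 - a * P + c5 * P - a * P ^+ 2 - a * P ^+ 4 - a * P ^+ 5
                + c1 * P ^+ 5 - c2 * P ^+ 4 + c3 * P ^+ 2 + c3 * P ^+ 4
                + c4 * P ^+ 4)
               / (2 * P ^+ 7 - 4 * P ^+ 5 + 2 * P ^+ 3)),
          2 * n3 =
            (b - c5 + a * P - c3 * P) / (P ^+ 4 - P ^+ 6),
          x4 =
            - ((b + c4 - c5 - c6 + a * P - c3 * P + a * P ^+ 2 + a * P ^+ 3
                + a * P ^+ 4 - b * P ^+ 2 - c1 * P ^+ 4 - c2 * P ^+ 2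
                - c3 * P ^+ 3 + c4 * P ^+ 2)
               / (2 * P ^+ 10 - 2 * P ^+ 8 - 2 * P ^+ 6 + 2 * P ^+ 4))
        & y4 =
            - ((b - c4 - c5 + c6 + a * P - c3 * P + a * P ^+ 2 + a * P ^+ 3
                + a * P ^+ 4 - b * P ^+ 2 - c1 * P ^+ 4 + c2 * P ^+ 2
                - c3 * P ^+ 3 - c4 * P ^+ 2)
               / (2 * P ^+ 10 - 2 * P ^+ 8 - 2 * P ^+ 6 + 2 * P ^+ 4))]].
Proof.
have q0 : s ^+ 2 != 0 by rewrite expf_neq0.
have E1 : x0 + y0 + 2 * n1 + x2 + y2 + 2 * n3 + x4 + y4 = c1.
  by rewrite c1E H0; ring.
have E2 : x0 - y0 + 3 * (x2 - y2) + 9 * (x4 - y4) = c2.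
  by apply: (mulfI s0); rewrite H1 c2E; ring.
have E3 : x0 + y0 - 6 * n1 + 9 * (x2 + y2) - 54 * n3 + 81 * (x4 + y4) = c3.
  by apply: (mulfI q0); rewrite H2 c3E; ring.
(* Averaging the moments of S^2 and |S|^2 eliminates [n1] and [n3]; [Eb] does the same in order
   4. *)
have Ea : x0 + y0 + 9 * (x2 + y2) + 81 * (x4 + y4) = a.
  apply: (mulfI q0); rewrite aE; move: H2 H11; lra.
have E4 : x0 - y0 + 27 * (x2 - y2) + 3 ^+ 6 * (x4 - y4) = c4.
  by apply: (mulfI (expf_neq0 3 s0)); rewrite H21 c4E; ring.
have E5 : x0 + y0 + 18 * n1 + 81 * (x2 + y2) + 2 * 3 ^+ 6 * n3 + 3 ^+ 8 * (x4 + y4) = c5.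
  by apply: (mulfI (expf_neq0 2 q0)); rewrite H22 c5E; ring.
have Eb : x0 + y0 + 81 * (x2 + y2) + 3 ^+ 8 * (x4 + y4) = b.
  apply: (mulfI (expf_neq0 2 q0)); rewrite bE; move: H22 H31; lra.
have E6 : x0 - y0 + 243 * (x2 - y2) + 3 ^+ 10 * (x4 - y4) = c6.
  by apply: (mulfI (expf_neq0 5 s0)); rewrite H32 c6E; ring.
(* With the constants replaced by linear forms in the counts, each formula is an identity in the
   eight unknowns. *)
rewrite -E1 -E2 -E3 -Ea -E4 -E5 -Eb -E6.
by do ![split]; field.
Qed.

End System.

Theorem lemma17 (R : realType) (p m : nat) (F : finFieldType)
    (hp : p = 3%N) (hm : (6 <= m)%N) (m_even : ~~ odd m)
    (cardF : #|F| = (p ^ m)%N) :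
  let P : rat := p%:R in
  let n_ (eps : int) (j : nat) : rat := (nval R p m F eps j)%:R in
  let n1 : rat := (nval_odd R p m F 1)%:R in
  let n3 : rat := (nval_odd R p m F 3)%:R in
  let a := a_const p m in let b := b_const p m in
  let c1 := c1 p m in let c2 := c2 p m in let c3 := c3 p m in
  let c4 := c4 p m in let c5 := c5 p m in let c6 := c6 p m in
  [/\ n_ 1 0%N =
        - ((b + c6 - a * P ^+ 2 - a * P ^+ 3 - a * P ^+ 4 - a * P ^+ 5
            - b * P ^+ 2 + c1 * P ^+ 6 + c2 * P ^+ 6 + c3 * P ^+ 3
            + c3 * P ^+ 5 - c4 * P ^+ 2 - c4 * P ^+ 4 + c5 * P ^+ 2)
           / (- 2 * P ^+ 6 + 2 * P ^+ 4 + 2 * P ^+ 2 - 2)),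
      n_ (- 1) 0%N =
        - ((b - c6 - a * P ^+ 2 - a * P ^+ 3 - a * P ^+ 4 - a * P ^+ 5
            - b * P ^+ 2 + c1 * P ^+ 6 - c2 * P ^+ 6 + c3 * P ^+ 3
            + c3 * P ^+ 5 + c4 * P ^+ 2 + c4 * P ^+ 4 + c5 * P ^+ 2)
           / (- 2 * P ^+ 6 + 2 * P ^+ 4 + 2 * P ^+ 2 - 2)),
      2 * n1 =
        - (b - c5 + a * P ^+ 3 - c3 * P ^+ 3) / (P ^+ 2 - P ^+ 4),
      n_ 1 2%N =
        (c4 - c6 + a * P - c5 * P + a * P ^+ 2 + a * P ^+ 4 + a * P ^+ 5
         - c1 * P ^+ 5 - c2 * P ^+ 4 - c3 * P ^+ 2 - c3 * P ^+ 4
         + c4 * P ^+ 4)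
        / (2 * P ^+ 7 - 4 * P ^+ 5 + 2 * P ^+ 3)
    & [/\ n_ (- 1) 2%N =
            - ((c4 - c6 - a * P + c5 * P - a * P ^+ 2 - a * P ^+ 4 - a * P ^+ 5
                + c1 * P ^+ 5 - c2 * P ^+ 4 + c3 * P ^+ 2 + c3 * P ^+ 4
                + c4 * P ^+ 4)
               / (2 * P ^+ 7 - 4 * P ^+ 5 + 2 * P ^+ 3)),
          2 * n3 =
            (b - c5 + a * P - c3 * P) / (P ^+ 4 - P ^+ 6),
          n_ 1 4%N =
            - ((b + c4 - c5 - c6 + a * P - c3 * P + a * P ^+ 2 + a * P ^+ 3
                + a * P ^+ 4 - b * P ^+ 2 - c1 * P ^+ 4 - c2 * P ^+ 2
                - c3 * P ^+ 3 + c4 * P ^+ 2)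
               / (2 * P ^+ 10 - 2 * P ^+ 8 - 2 * P ^+ 6 + 2 * P ^+ 4))
        & n_ (- 1) 4%N =
            - ((b - c4 - c5 + c6 + a * P - c3 * P + a * P ^+ 2 + a * P ^+ 3
                + a * P ^+ 4 - b * P ^+ 2 - c1 * P ^+ 4 + c2 * P ^+ 2
                - c3 * P ^+ 3 - c4 * P ^+ 2)
               / (2 * P ^+ 10 - 2 * P ^+ 8 - 2 * P ^+ 6 + 2 * P ^+ 4))]].
Proof.
(* Writing m = 2 k makes s = 3^k the square root of q. *)
subst p; have mE : m = (2 * m./2)%N by rewrite mul2n -[LHS]odd_double_half (negbTE m_even).
have k_ge3 : (3 <= m./2)%N by lia.
move: (m./2) k_ge3 mE => k k_ge3 mE; subst m.
have [E0 E1 E2 [E11 E21 E22 E31 E32]] := count_equations R cardF.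
have cast (u v : int) : u = v -> u%:~R = v%:~R :> rat by move->.
move: E0 E1 E2 E11 E21 E22 E31 E32; cbv beta zeta; rewrite /nval_odd.
have sE : 3 ^+ k = (3 ^+ k : int)%:~R :> rat by rewrite rmorphXn.
move: (nval R _ _ F 1 0) (nval R _ _ F (-1) 0) (nval R _ _ F 1 1) (nval R _ _ F 1 2) (nval R _ _ F (-1) 2).
move: (nval R _ _ F 1 3) (nval R _ _ F 1 4) (nval R _ _ F (-1) 4) => ? ? ? ? ? ? ? ?.
move=> E0 E1 E2 E11 E21 E22 E31 E32.
have s0 : 3 ^+ k != 0 :> rat by rewrite expf_neq0.
apply: (solve_moments s0 (c1E k) (c2E k) (c3E k) (c4E k) (c5E k) (c6E k) (aE k_ge3) (bE k_ge3));
  rewrite sE; [move: E0|move: E1|move: E2|move: E11|move: E21|move: E22|move: E31|move: E32];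
  by move: (3 ^+ k) => s /cast e; apply: (etrans _ (etrans e _)); ring.
Qed.
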